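(* Let $\alpha,\beta,\kappa,\theta$ be generic, let $m,n\ge1$ and let $\lambda',\lambda$ be Young diagrams with $f=m-|\lambda'|=n-|\lambda|\ge0$. In the seminormal representation of $\mathrm{qwB}_{m,n}(\alpha,\beta,\kappa,\theta)$ on the span of the standard triples $\mathcal{T}_{m,n}(\lambda',\lambda)$ (described in the context), the Jucys–Murphy elements $J^{(n)}_2,\dots,J^{(n)}_{m+n}$ act diagonally on the basis of standard triples: for every standard triple $\tau=(B,S,W)$, $$J^{(n)}_j\,\tau=\mathrm{Wt}(\tau)_{j-1}\,\tau,\qquad j=2,\dots,m+n.$$
   Context: $\mathrm{qwB}_{m,n}(\alpha,\beta,\kappa,\theta)$ is the algebra generated by $g_1,\dots,g_{m-1}$, $h_1,\dots,h_{n-1}$, $E$ with relations: $g_j^2=(\alpha+\beta)g_j-\alpha\beta$, $h_i^2=(\alpha+\beta)h_i-\alpha\beta$; type-$A$ braid relations among the $g$'s and among the $h$'s; $g_jh_i=h_ig_j$; $E^2=\frac{\theta+1}{\kappa(\alpha+\beta)}E$; $Eg_1E=\kappa^{-1}E=Eh_1E$; $E$ commutes with $g_j$ ($j\ge2$) and $h_i$ ($i\ge2$); $Eg_1h_1^{-1}E(g_1-h_1)=0=(g_1-h_1)Eg_1h_1^{-1}E$. Jucys–Murphy elements: $J^{(n)}_1=1$, $J^{(n)}_i=(-\alpha\beta)^{-1}h_{n+1-i}J^{(n)}_{i-1}h_{n+1-i}$ for $2\le i\le n$; $J^{(n)}_{n+1}=1-(\alpha+\beta)\kappa\sum_{i=1}^{n}(-\alpha\beta)^{i-1}(h_{i-1}^{-1}h_{i-2}^{-1}\cdots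 h_1^{-1})\,E\,(h_1^{-1}h_2^{-1}\cdots h_{i-1}^{-1})$ (empty products equal $1$); $J^{(n)}_{n+j}=(-\alpha\beta)^{-1}g_{j-1}J^{(n)}_{n+j-1}g_{j-1}$ for $2\le j\le m$. Conventions: box in row $i$, column $j$ has position $(i,j)$, $\mathrm{HD}((i,j))=i-j$, $\mathrm{HD}(p_1,p_2)=\mathrm{HD}(p_1)-\mathrm{HD}(p_2)$, $q=-\beta/\alpha$. A standard triple $(B,S,W)$: $W$ standard with entries $1,\dots,n$ on a diagram $\tilde\lambda\supseteq\lambda$, $|\tilde\lambda/\lambda|=f$; $B$ a standard tableau on $\lambda'$ and $S$ an antistandard filling (strictly decreasing along rows and columns) of $\tilde\lambda/\lambda$, jointly using each of $1'<\dots<m'$ once. Weight $\mathrm{Wt}(B,S,W)=\mu\in\mathbb{C}^{m+n-1}$: $\mu_i=q^{\mathrm{HD}(\mathrm{pos}_W(i+1))}$ ($1\le i\le n-1$); $\mu_{n-1+i}=q^{\mathrm{HD}(\mathrm{pos}_B(i'))}$ if $i'\in B$, $\mu_{n-1+i}=-\theta q^{-\mathrm{HD}(\mathrm{pos}_S(i'))}$ if $i'\in S$. Seminormal action (with $F(x)=\frac{(1+x\beta/\alpha)(1+x\alpha/\beta)}{(1-x)^2}$ and functions $\eta,\zeta$ satisfying $\eta(x)\eta(1/x)=\zeta(x)\zeta(1/x)=-\alpha\beta F(x)$ and $\frac{\eta(x)\zeta(x)\eta(y)\zeta(y)}{\eta(xy)\zeta(xy)}=-\alpha\beta\frac{F(x)F(y)}{F(xy)}$):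 $h_{n-i}(B,S,W)$ is $\alpha(B,S,W)$ or $\beta(B,S,W)$ if $i,i+1$ lie in the same row or column of $W$, else $\frac{\alpha+\beta}{1-\mu_{i-1}/\mu_i}(B,S,W)+\eta(\mu_{i-1}/\mu_i)(B,S,W_{(i,i+1)})$; $g_j(B,S,W)$ is $\alpha(B,S,W)$ or $\beta(B,S,W)$ if $j',(j+1)'$ lie in the same row or column of $B$ or of $S$, else $\frac{\alpha+\beta}{1-\mu_{n+j-1}/\mu_{n+j}}(B,S,W)+\zeta(\mu_{n+j-1}/\mu_{n+j})((B,S)_{(j,j+1)},W)$; $E(B,S,W)=0$ unless $1'\in S$ and the box $b_0$ of $S$ holding $1'$ holds $n$ in $W$, in which case, with $\nu=\tilde\lambda\setminus b_0$ and $(S_b,W_b)$ obtained by moving that box to an addable box $b$ of $\nu$, $E(B,S,W)=\frac{1+\theta q^{-\mathrm{HD}(b_0)}}{\kappa(\alpha+\beta)}\sum_{b}\frac{\prod_{\delta\in\mathrm{Corners}(\nu)}(1-q^{\mathrm{HD}(\delta,b)})}{\prod_{b'\ne b}(1-q^{\mathrm{HD}(b',b)})}(B,S_b,W_b)$, sums/products over addable boxes $b,b'$ of $\nu$ and corners (removable boxes) $\delta$ of $\nu$. *)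

(* Defs.v *)
From HB Require Import structures.
From mathcomp Require Import all_boot all_order all_algebra.
From mathcomp Require Import reals.
From mathcomp.real_closed Require Import complex.
Set Implicit Arguments. Unset Strict Implicit. Unset Printing Implicit Defensive.
Import Order.TTheory GRing.Theory Num.Theory.
Local Open Scope ring_scope.

(* A box (row, column), 0-based; HD((i,j)) = i - j (invariant under shifting). *)
Definition box := (nat * nat)%type.
Definition HD (b : box) : int := (b.1)%:Z - (b.2)%:Z.

(* A triple (B,S,W):
   - first component: list of length m; entry k (0-based) describes the primed
     label (k+1)': (true, pos) if (k+1)' lies in B at pos, (false, pos) if it
     lies in S at pos;
   - second component: list of length n; entry k (0-based) is the position of
     label k+1 in W. *)
Definition triple := (seq (bool * box) * seq box)%type.

Definition ydiagram (la : seq nat) : bool :=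
  sorted geq la && all (fun x => 0 < x)%N la.
Definition ydboxes (la : seq nat) : seq box :=
  [seq (i, j) | i <- iota 0 (size la), j <- iota 0 (nth 0%N la i)].

Definition downclosed (D : seq box) : bool :=
  all (fun b => ((b.1 == 0%N) || ((b.1.-1, b.2) \in D)) &&
                ((b.2 == 0%N) || ((b.1, b.2.-1) \in D))) D.
Definition addable (D : seq box) : seq box :=
  [seq b <- [seq (i, j) | i <- iota 0 (size D).+1, j <- iota 0 (size D).+1]
     | (b \notin D) && downclosed (b :: D)].
Definition corners (D : seq box) : seq box :=
  [seq b <- D | downclosed (filter (predC1 b) D)].

Definition before (a b : box) : bool :=
  ((a.1 == b.1) && (a.2 < b.2)%N) || ((a.2 == b.2) && (a.1 < b.1)%N).

Definition standardTriple (m n : nat) (lam' lam : seq nat) (t : triple) : bool :=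
  let BS := t.1 in let W := t.2 in
  let Bpos := [seq p.2 | p <- BS & p.1] in
  let Spos := [seq p.2 | p <- BS & ~~ p.1] in
  [&& (* W : standard tableau on a diagram lam~ containing lam, entries 1..n *)
      size W == n, uniq W, downclosed W, all (fun b => b \in W) (ydboxes lam),
      all (fun k => all (fun l =>
          before (nth (0,0)%N W k) (nth (0,0)%N W l) ==> (k < l)%N) (iota 0 n)) (iota 0 n),
      (* B standard on lam', S antistandard on lam~/lam, jointly 1'..m' *)
      size BS == m,
      perm_eq Bpos (ydboxes lam'),
      perm_eq Spos [seq b <- W | b \notin ydboxes lam],
      all (fun k => all (fun l =>
          let a := nth (true, (0,0)%N) BS k in let c := nth (true, (0,0)%N) BS l in
          (a.1 && c.1 && before a.2 c.2) ==> (k < l)%N) (iota 0 m)) (iota 0 m) &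
      all (fun k => all (fun l =>
          let a := nth (true, (0,0)%N) BS k in let c := nth (true, (0,0)%N) BS l in
          (~~ a.1 && ~~ c.1 && before a.2 c.2) ==> (l < k)%N) (iota 0 m)) (iota 0 m)].

Definition swap {T : Type} (x0 : T) (s : seq T) (k : nat) : seq T :=
  [seq nth x0 s (if i == k then k.+1 else if i == k.+1 then k else i)
     | i <- iota 0 (size s)].

Definition eval4 {C : fieldType} (P : {poly {poly {poly {poly C}}}}) (a b k t : C) : C :=
  (((P.[(t%:P)%:P%:P]).[(k%:P)%:P]).[b%:P]).[a].

Section Seminormal.
Variables (C : fieldType) (al be ka th : C) (eta zeta : C -> C) (m n : nat).

Definition F (x : C) : C := (1 + x * be / al) * (1 + x * al / be) / ((1 - x) ^+ 2).

(* conditions on eta, zeta, required wherever the expressions make sense *)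
Definition eta_zeta_ok : Prop :=
  (forall x, x != 0 -> x != 1 ->
     eta x * eta x^-1 = - (al * be) * F x /\ zeta x * zeta x^-1 = - (al * be) * F x) /\
  (forall x y, x != 0 -> x != 1 -> y != 0 -> y != 1 -> x * y != 0 -> x * y != 1 ->
     F (x * y) != 0 ->
     eta x * zeta x * eta y * zeta y / (eta (x * y) * zeta (x * y))
       = - (al * be) * (F x * F y / F (x * y))).

(* formal linear combinations of triples, operators given on basis elements *)
Definition vec := seq (C * triple).
Definition op := triple -> vec.
Definition vscale (c : C) (v : vec) : vec := [seq (c * p.1, p.2) | p <- v].
Definition vapply (A : op) (v : vec) : vec := flatten [seq vscale p.1 (A p.2) | p <- v].
Definition opcomp (A B : op) : op := fun t => vapply A (B t).
Definition opadd (A B : op) : op := fun t => A t ++ B t.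
Definition opscale (c : C) (A : op) : op := fun t => vscale c (A t).
Definition opid : op := fun t => [:: (1, t)].
Definition opzero : op := fun _ => [::].
Definition coef (v : vec) (t : triple) : C := \sum_(p <- v | p.2 == t) p.1.

Definition q : C := - be / al.

(* weight: mu t k, for k = 0 .. m+n-1 (mu t 0 = q^{HD(pos_W(1))} = 1) *)
Definition mu (t : triple) (k : nat) : C :=
  if (k < n)%N then q ^ (HD (nth (0,0)%N t.2 k))
  else let p := nth (true, (0,0)%N) t.1 (k - n) in
       if p.1 then q ^ (HD p.2) else - th * q ^ (- HD p.2).

(* action of h_{n-i}: acts on the labels i, i+1 of W (1 <= i <= n-1) *)
Definition hW (i : nat) : op := fun t =>
  let a := nth (0,0)%N t.2 i.-1 in let b := nth (0,0)%N t.2 i in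
  if a.1 == b.1 then [:: (al, t)]
  else if a.2 == b.2 then [:: (be, t)]
  else let x := mu t i.-1 / mu t i in
       [:: ((al + be) / (1 - x), t); (eta x, (t.1, swap (0,0)%N t.2 i.-1))].

Definition h (k : nat) : op := hW (n - k).

(* h_k^{-1} = ((al+be) - h_k) / (al be), from the quadratic relation *)
Definition hinv (k : nat) : op :=
  opscale (al * be)^-1 (opadd (opscale (al + be) opid) (opscale (-1) (h k))).

(* action of g_j, 1 <= j <= m-1: acts on labels j', (j+1)' *)
Definition g (j : nat) : op := fun t =>
  let a := nth (true, (0,0)%N) t.1 j.-1 in let b := nth (true, (0,0)%N) t.1 j in
  if (a.1 == b.1) && (a.2.1 == b.2.1) then [:: (al, t)]
  else if (a.1 == b.1) && (a.2.2 == b.2.2) then [:: (be, t)]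
  else let x := mu t (n + j).-1 / mu t (n + j) in
       [:: ((al + be) / (1 - x), t); (zeta x, (swap (true, (0,0)%N) t.1 j.-1, t.2))].

Definition coefE (b0 : box) (nu : seq box) (b : box) : C :=
  (1 + th * q ^ (- HD b0)) / (ka * (al + be)) *
  ((\prod_(d <- corners nu) (1 - q ^ (HD d - HD b))) /
   (\prod_(b' <- addable nu | b' != b) (1 - q ^ (HD b' - HD b)))).

Definition Eop : op := fun t =>
  let p := nth (true, (0,0)%N) t.1 0 in
  if ~~ p.1 && (p.2 == nth (0,0)%N t.2 n.-1) then
    let nu := filter (predC1 p.2) t.2 in
    [seq (coefE p.2 nu b,
          (set_nth (true, (0,0)%N) t.1 0 (false, b), set_nth (0,0)%N t.2 n.-1 b))
       | b <- addable nu]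
  else [::].

Fixpoint Jlow (i : nat) : op :=
  match i with
  | 0 => opid
  | 1 => opid
  | i'.+1 => opscale (- (al * be))^-1 (opcomp (h (n - i')) (opcomp (Jlow i') (h (n - i'))))
  end.

Definition hinvL (k : nat) : op := foldr opcomp opid [seq hinv l | l <- rev (iota 1 k)].
Definition hinvR (k : nat) : op := foldr opcomp opid [seq hinv l | l <- iota 1 k].

Definition Jn1 : op :=
  opadd opid (opscale (- ((al + be) * ka))
    (foldr opadd opzero
       [seq opscale ((- (al * be)) ^+ i.-1) (opcomp (hinvL i.-1) (opcomp Eop (hinvR i.-1)))
          | i <- iota 1 n])).

(* Jup j = J_{n+j} for j >= 1 *)
Fixpoint Jup (j : nat) : op :=
  match j with
  | 0 => Jlow n
  | 1 => Jn1
  | j'.+1 => opscale (- (al * be))^-1 (opcomp (g j') (opcomp (Jup j') (g j')))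
  end.

Definition J (k : nat) : op := if (k <= n)%N then Jlow k else Jup (k - n).

End Seminormal.

(* Main.v *)
(** Every J_j with j <> n+1 is obtained from its predecessor by conjugation with a generator,
    which on a pair of triples exchanged by a label swap is a 2x2 computation; so the point is
    J_(n+1).  There the h's only move labels of W, and the sum over i of the conjugates of E
    becomes, for boxes b and b', a sum of conjugates of the operator moving the largest label
    from b to b'.  By induction on the size of W this sum is the scalar 1 / d(b) if b = b' and
    0 otherwise, where d(b) is the coefficient of (B, S_b, W_b) in E up to the common factor.
    The induction step needs two identities for d, a step formula and a summation over corners.
    Writing d(b) = C(v_b) / A'(v_b) with A and C the polynomials whose roots are the q-contents
    of the addable boxes and of the corners, both follow from how A and C change when a corner
    is removed, the second one by Lagrange interpolation. *)
Require Import Defs.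
From HB Require Import structures.
From mathcomp Require Import all_boot all_order all_algebra.
From mathcomp Require Import reals.
From mathcomp.real_closed Require Import complex.
From mathcomp Require Import zify ring.
Import Order.TTheory GRing.Theory Num.Theory.
Local Open Scope ring_scope.
Local Open Scope complex_scope.
Set Implicit Arguments. Unset Strict Implicit. Unset Printing Implicit Defensive.

(** * Corners and addable boxes *)

(** The sum in $J_{n+1}$ is unrolled from the inside: in each term only the innermost generator
    $h_1$ moves the label $n$, the others move smaller labels. Conjugating by $h_1$ turns an
    operator moving $n$ into a combination of operators moving $n-1$, each followed by a prescribed
    box for $n$, and what remains is a sum of the same form with one label less. So the inductive
    claim has to cover all pairs of boxes and arbitrary test functions on the resulting fillings,
    not just the pairs that survive in the end. The coefficients stay uniform because
    $q=-\beta/\alpha$ gives $1-q=(\alpha+\beta)/\alpha$ and $1-q^{-1}=(\alpha+\beta)/\beta$: the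
    values $\alpha$ and $\beta$ for adjacent boxes are instances of the generic diagonal expression.
    Hence the sum over corners needs no exceptional terms and interpolation applies to it
    directly. *)

Lemma downclosedP (D : seq box) :
  reflect ((forall i j, (i.+1, j) \in D -> (i, j) \in D) /\
           (forall i j, (i, j.+1) \in D -> (i, j) \in D)) (downclosed D).
Proof.
apply: (iffP allP) => [H|[Hr Hc] [i j] ij].
  by split=> i j /H /andP[/= H1 H2].
apply/andP; split=> /=.
  by case: i ij => [|i] //= /Hr ->; rewrite ?orbT.
by case: j ij => [|j] //= /Hc ->; rewrite ?orbT.
Qed.

Lemma eq_downclosed (D D' : seq box) : D =i D' -> downclosed D = downclosed D'.
Proof.
move=> e; rewrite /downclosed (eq_all_r e); apply: eq_all => b; by rewrite !e.
Qed.

Lemma downclosed_le (D : seq box) (i j k l : nat) :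
  downclosed D -> (k, l) \in D -> (i <= k)%N -> (j <= l)%N -> (i, j) \in D.
Proof.
move=> /downclosedP[Hr Hc] kl lik ljl.
have il : (i, l) \in D.
  move: kl; rewrite -(subnK lik); elim: (k - i)%N => [|d IH] //= /Hr; exact: IH.
move: il; rewrite -(subnK ljl); elim: (l - j)%N => [|d IH] //= /Hc; exact: IH.
Qed.

(** The part of the column above the box, and the part of the row to its left, consist of distinct
    boxes of [D]. This is why the finite search grid in [addable] misses nothing. *)
Lemma downclosed_bound (D : seq box) (i j : nat) :
  downclosed D -> (i, j) \in D -> (i < size D)%N && (j < size D)%N.
Proof.
move=> dD ij; apply/andP; split.
  have := uniq_leq_size (s1 := [seq (k, j) | k <- iota 0 i.+1]) (s2 := D).
  rewrite size_map size_iota; apply; first by rewrite map_inj_uniq ?iota_uniq // => ? ? [].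
  move=> b /mapP[k]; rewrite mem_iota add0n ltnS => /= ki ->.
  exact: (downclosed_le dD ij).
have := uniq_leq_size (s1 := [seq (i, k) | k <- iota 0 j.+1]) (s2 := D).
rewrite size_map size_iota; apply; first by rewrite map_inj_uniq ?iota_uniq // => ? ? [].
move=> b /mapP[k]; rewrite mem_iota add0n ltnS => /= ki ->.
exact: (downclosed_le dD ij).
Qed.

Lemma addableE (D : seq box) (b : box) :
  (b \in addable D) = (b \notin D) && downclosed (b :: D).
Proof.
rewrite mem_filter andb_idr //; case: b => i j /andP[_ /downclosed_bound].
move=> /(_ i j (mem_head _ _)) /andP[lti ltj].
by apply/allpairsP; exists (i, j); rewrite !mem_iota.
Qed.

Lemma addable_notin (D : seq box) b : b \in addable D -> b \notin D.
Proof. by rewrite addableE => /andP[]. Qed.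

Lemma uniq_addable (D : seq box) : uniq (addable D).
Proof.
apply: filter_uniq; apply: allpairs_uniq; rewrite ?iota_uniq //.
by move=> [? ?] [? ?].
Qed.

Lemma eq_addable (D D' : seq box) :
  D =i D' -> size D = size D' -> addable D = addable D'.
Proof.
move=> e es; rewrite /addable es; apply: eq_filter => b; rewrite e.
by congr (_ && _); apply: eq_downclosed => x; rewrite !inE e.
Qed.

Lemma addableP (D : seq box) (i j : nat) : downclosed D ->
  ((i, j) \in addable D) =
  [&& (i, j) \notin D, (i == 0%N) || ((i.-1, j) \in D) & (j == 0%N) || ((i, j.-1) \in D)].
Proof.
move=> dD; rewrite addableE /downclosed /= !inE /=.
rewrite (_ : all _ D = true); last first.
  apply/allP=> -[k l] kl; have := allP dD _ kl.
  by rewrite /= !inE => /andP[/orP[->|->] /orP[->|->]]; rewrite ?orbT.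
rewrite andbT; congr (_ && (_ && _)).
  by case: i => //= i; rewrite xpair_eqE eqn_leq ltnn /= andbF.
by case: j => //= j; rewrite xpair_eqE (eqn_leq j) ltnn /= !andbF.
Qed.

Lemma cornersE (D : seq box) (i j : nat) : downclosed D ->
  ((i, j) \in corners D) = [&& (i, j) \in D, (i.+1, j) \notin D & (i, j.+1) \notin D].
Proof.
move=> dD; rewrite mem_filter andbC; case ij: (_ \in D) => //=.
apply/downclosedP/andP => [[Hr Hc]|[nr nc]].
  by split; apply/negP => H; [have := Hr i j | have := Hc i j];
    rewrite !mem_filter /= H eqxx /= xpair_eqE eqxx ?(gtn_eqF (ltnSn _)) ?andbF;
    move=> /(_ isT).
move/downclosedP: dD => [Hr Hc].
split=> k l; rewrite !mem_filter /= => /andP[_ kl]; rewrite ?(Hr _ _ kl) ?(Hc _ _ kl) andbT;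
  apply/eqP => -[??]; subst k l; first by rewrite kl in nr.
by rewrite kl in nc.
Qed.

Lemma corner_mem (D : seq box) b : b \in corners D -> b \in D.
Proof. by rewrite mem_filter => /andP[]. Qed.

Lemma uniq_corners (D : seq box) : uniq D -> uniq (corners D).
Proof. exact: filter_uniq. Qed.

Lemma perm_corners (D D' : seq box) : perm_eq D D' -> perm_eq (corners D) (corners D').
Proof.
move=> e; rewrite /corners.
rewrite (eq_filter (a2 := fun b => downclosed [seq x <- D' | predC1 b x])).
  exact: perm_filter.
by move=> b; apply: eq_downclosed => x; rewrite !mem_filter (perm_mem e).
Qed.

Definition shift (i j : nat) (b : box) : box := ((b.1 + i)%N, (b.2 + j)%N).

Lemma shift_inj i j : injective (shift i j).
Proof. by move=> [a b] [c d] [] /addIn -> /addIn ->. Qed.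

Lemma count_shift (k l : nat) (D : seq box) (i j : nat) : uniq D ->
  count_mem (i, j) (map (shift k l) D) =
    [&& (k <= i)%N, (l <= j)%N & (i - k, j - l)%N \in D].
Proof.
move=> uD; rewrite count_uniq_mem ?(map_inj_uniq (@shift_inj k l)) //; congr nat_of_bool.
apply/mapP/and3P => [[[a b] ab [-> ->]]|[ki lj ab]].
  by rewrite !leq_addl !addnK.
by exists (i - k, j - l)%N; rewrite // /shift /= !subnK.
Qed.

(* At the box (i, j) this is a count over the four boxes (i, j), (i-1, j), (i, j-1), (i-1, j-1). *)
Lemma perm_addable_corners (D : seq box) : uniq D -> downclosed D ->
  perm_eq (addable D ++ D ++ map (shift 1 1) D)
          ((0%N, 0%N) :: map (shift 1 0) D ++ map (shift 0 1) D
             ++ map (shift 1 1) (corners D)).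
Proof.
move=> uD dD; apply/allP => -[i j] _; apply/eqP.
rewrite /= !count_cat !count_shift ?uniq_corners // !count_uniq_mem ?uniq_addable //.
rewrite !subn0 !leq0n !addableP //=; have [Hr Hc] := downclosedP _ dD.
case: i => [|i]; case: j => [|j]; rewrite ?ltn0 ?andbF ?eqxx ?subn1 ?xpair_eqE /= ?andbT.
- by case: (_ \in D).
- by move: (Hc 0%N j); case: ((0%N, j) \in D); case: ((0%N, j.+1) \in D) => // /(_ isT).
- by move: (Hr i 0%N); case: ((i, 0%N) \in D); case: ((i.+1, 0%N) \in D) => // /(_ isT).
rewrite ?cornersE // ?subn1 /=.
move: (Hr i j) (Hc i j) (Hr i j.+1) (Hc i.+1 j).
case: ((i, j) \in D); case: ((i.+1, j) \in D); case: ((i, j.+1) \in D);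
  case: ((i.+1, j.+1) \in D) => //= H1 H2 H3 H4;
  by [move: (H1 isT) | move: (H2 isT) | move: (H3 isT) | move: (H4 isT)].
Qed.

(** Only the lengths in [perm_addable_corners] are compared. The count supplies the degrees for the
    interpolation arguments and balances the powers of [wt b] in [transitionE]. *)
Lemma size_addable (D : seq box) : uniq D -> downclosed D ->
  size (addable D) = (size (corners D)).+1.
Proof.
move=> uD dD; have := perm_size (perm_addable_corners uD dD).
rewrite /= !size_cat !size_map => e; apply: (@addIn (size D + size D)%N).
by rewrite {}e addSn [in RHS]addnC addnA.
Qed.

Lemma corner_remove (D : seq box) (z : box) :
  downclosed D -> z \in corners D -> downclosed [seq x <- D | x != z].
Proof. by move=> _; rewrite mem_filter => /andP[]. Qed.

Lemma corner_addable (D : seq box) (z : box) :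
  downclosed D -> z \in corners D -> z \in addable [seq x <- D | x != z].
Proof.
move=> dD zc; rewrite addableE mem_filter eqxx /=.
rewrite (eq_downclosed (D' := D)) // => x; rewrite inE mem_filter.
by case: eqP => //= ->; rewrite (corner_mem zc).
Qed.

Definition collinear (a b : box) : bool := (a.1 == b.1) || (a.2 == b.2).

Lemma collinearC a b : collinear a b = collinear b a.
Proof. by rewrite /collinear eq_sym [in X in _ || X]eq_sym. Qed.

(** A corner ends its row and its column, an addable box directly follows the end of its own; a
    shared line therefore makes them adjacent. *)
Lemma corner_addable_collinear (D : seq box) (z b : box) :
  downclosed D -> z \in corners D -> b \in addable D ->
  collinear z b -> HD b = HD z - 1 /\ z.1 = b.1 \/ HD b = HD z + 1 /\ z.2 = b.2.
Proof.
case: z b => [i j] [k l] dD; rewrite cornersE // addableP // /collinear /HD /=.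
move=> /and3P[ij nij1 nij2] /and3P[nkl kl1 kl2] /orP[]/eqP e; subst.
  left; split=> //; suff -> : l = j.+1 by lia.
  case: (ltngtP l j) => [lj|jl|e]; last by rewrite e ij in nkl.
    by rewrite (downclosed_le dD ij) ?(ltnW lj) in nkl.
  case: l jl kl2 {nkl kl1} => //= l; rewrite ltnS => jl ml.
  case: (ltngtP j l) jl => [jl|//|-> //] _.
  by rewrite (downclosed_le dD ml) in nij2.
right; split=> //; suff -> : k = i.+1 by lia.
case: (ltngtP k i) => [lj|jl|e]; last by rewrite e ij in nkl.
  by rewrite (downclosed_le dD ij) ?(ltnW lj) in nkl.
case: k jl kl1 {nkl kl2} => //= k; rewrite ltnS => jl ml.
case: (ltngtP i k) jl => [jl|//|-> //] _.
by rewrite (downclosed_le dD ml) in nij1.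
Qed.

(** On a common diagonal, an addable box weakly north-west of the corner would lie in [D]. Otherwise
    the box to the right of the corner is weakly north-west of the box above the addable one, and
    would lie in [D]. *)
Lemma corner_addable_HD (D : seq box) (z b : box) :
  downclosed D -> z \in corners D -> b \in addable D -> HD z <> HD b.
Proof.
case: z b => [i j] [k l] dD; rewrite cornersE // addableP // /HD /=.
move=> /and3P[ij nij1 nij2] /and3P[nkl kl1 kl2] e.
have [ki|ik] := leqP k i.
  by rewrite (downclosed_le dD ij) // in nkl; lia.
case: k ik kl1 e {nkl kl2} => //= k ik kl e.
by rewrite (downclosed_le dD kl) // in nij2; lia.
Qed.

Lemma corners_HD_inj (D : seq box) (z b : box) :
  downclosed D -> z \in corners D -> b \in corners D -> HD z = HD b -> z = b.
Proof.
case: z b => [i j] [k l] dD; rewrite !cornersE // /HD /=.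
move=> /and3P[ij nij1 nij2] /and3P[kl nkl1 nkl2] e.
case: (ltngtP i k) => ik.
- by rewrite (downclosed_le dD kl) // in nij1; lia.
- by rewrite (downclosed_le dD ij) // in nkl1; lia.
by congr pair; lia.
Qed.

Lemma corners_not_collinear (D : seq box) (z b : box) :
  downclosed D -> z \in corners D -> b \in corners D -> z != b -> ~~ collinear z b.
Proof.
case: z b => [i j] [k l] dD; rewrite !cornersE // /collinear xpair_eqE /=.
move=> /and3P[ij nij1 nij2] /and3P[kl nkl1 nkl2] ne.
have [e|_] := eqVneq i k; have [e'|_] := eqVneq j l; rewrite ?orbT //= in ne *.
- by rewrite e e' !eqxx in ne.
- subst k; case: (ltngtP j l) => jl; first by rewrite (downclosed_le dD kl) in nij2.
    by rewrite (downclosed_le dD ij) in nkl2.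
  by rewrite jl !eqxx in ne.
subst l; case: (ltngtP i k) => jl; first by rewrite (downclosed_le dD kl) in nij1.
  by rewrite (downclosed_le dD ij) in nkl1.
by rewrite jl !eqxx in ne.
Qed.

Lemma addable_HD_inj (D : seq box) (z b : box) :
  downclosed D -> z \in addable D -> b \in addable D -> HD z = HD b -> z = b.
Proof.
case: z b => [i j] [k l] dD; rewrite !addableP // /HD /=.
move=> /and3P[ij ij1 ij2] /and3P[kl kl1 kl2] e.
case: (ltngtP i k) => ik.
- case: k ik e kl kl1 kl2 => //= k ik e _ kl1 _.
  by rewrite (downclosed_le dD kl1) // in ij; lia.
- case: i ik e ij ij1 ij2 => //= i ik e _ ij1 _.
  by rewrite (downclosed_le dD ij1) // in kl; lia.
by congr pair; lia.
Qed.

(** Addability of [b] is tested on [b] and its upper and left neighbours, and [z] can be one of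
    these only if it shares a row or column with [b]. *)
Lemma corner_addableN (D : seq box) (z b : box) :
  downclosed D -> z \in corners D -> b \in addable D -> ~~ collinear z b ->
  b \in addable [seq x <- D | x != z].
Proof.
case: z b => [i j] [k l] dD zc; have dz := corner_remove dD zc.
rewrite !addableP // /collinear /= !mem_filter.
move=> /and3P[kl kl1 kl2]; rewrite negb_or => /andP[ne1 ne2].
rewrite !negb_and kl orbT /= (eq_sym l j) ne2 (eq_sym k i) ne1 orbT.
by move: kl1 kl2 => /orP[->|->] /orP[->|->]; rewrite ?orbT.
Qed.

Lemma HD_bound (D : seq box) (b : box) : downclosed D -> b \in D ->
  (`|HD b| < size D)%N.
Proof. case: b => i j dD /(downclosed_bound dD); rewrite /HD /=; lia. Qed.

Lemma HD_addable_bound (D : seq box) (b : box) : b \in addable D ->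
  (`|HD b| <= size D)%N.
Proof.
by rewrite addableE => /andP[_ dD]; have := HD_bound dD (mem_head _ _).
Qed.
(** * Transition weights *)

(** Interpolation at [size s] nodes reproduces a polynomial of smaller degree; the identity compares
    coefficients in degree [(size s).-1]. *)
Lemma lagrange_lead_coef (C : fieldType) (s : seq C) (p : {poly C}) :
  uniq s -> p \is monic -> size p = size s ->
  \sum_(x <- s) p.[x] / \prod_(y <- s | y != x) (x - y) = 1.
Proof.
move=> us pm sp; pose w x := \prod_(y <- s | y != x) ('X - y%:P).
have w_e x z : (w x).[z] = \prod_(y <- s | y != x) (z - y).
  by rewrite /w horner_prod; apply: eq_bigr => y _; rewrite !hornerE.
have w_x x : x \in s -> (w x).[x] != 0.
  move=> _; rewrite w_e prodf_seq_neq0; apply/allP => y _; apply/implyP => yx.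
  by move: yx; rewrite subr_eq0 eq_sym.
have w_z x z : z \in s -> z != x -> (w x).[z] = 0.
  move=> zs zx; rewrite w_e; apply/eqP; rewrite prodf_seq_eq0; apply/hasP.
  by exists z; rewrite // zx subrr eqxx.
have sw x : x \in s -> size (w x) = size s.
  move=> xs; rewrite /w -big_filter size_prod_XsubC size_filter.
  have := count_predC (pred1 x) s; rewrite count_uniq_mem // xs add1n => <-.
  by congr _.+1; apply: eq_count.
have wm x : w x \is monic.
  by apply: monic_prod => y _; apply: monicXsubC.
pose L := \sum_(x <- s) (p.[x] / (w x).[x]) *: w x.
have pL : p = L.
  apply/eqP; rewrite -subr_eq0; apply/eqP.
  apply: (@roots_geq_poly_eq0 _ _ s) => //; last first.
    rewrite (leq_trans (size_polyD _ _)) // size_polyN geq_max sp leqnn /=.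
    rewrite /L big_seq; apply: (big_ind (fun P : {poly C} => (size P <= size s)%N)).
    - by rewrite size_poly0.
    - by move=> P Q hP hQ; rewrite (leq_trans (size_polyD _ _)) // geq_max hP.
    by move=> x xs; rewrite (leq_trans (size_scale_leq _ _)) ?sw.
  apply/allP => z zs; rewrite /root !hornerE /L horner_sum (bigD1_seq z) //=.
  rewrite hornerZ divfK ?w_x // big_seq_cond big1 ?addr0 ?subrr // => x /andP[xs xz].
  by rewrite hornerZ (w_z x z) ?mulr0 1?eq_sym.
have := monicP pm; rewrite lead_coefE sp {1}pL /L coef_sum => e; rewrite -[RHS]e.
rewrite big_seq [RHS]big_seq; apply: eq_bigr => x xs.
rewrite coefZ -w_e -(sw x xs) -lead_coefE.
by rewrite (monicP (wm x)) mulr1.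
Qed.

Section Contents.
Variables (C : fieldType) (q : C).

(** Makes $q^x$ determine $x$ among integers at distance at most [N]. For a diagram [D] the bound
    used is [(size D).*2], since the contents involved have absolute value at most [size D]. *)
Definition q_generic (N : nat) : Prop :=
  q != 0 /\ (forall k : nat, (0 < k <= N)%N -> q ^+ k != 1).

Lemma q_generic_le (M N : nat) : (M <= N)%N -> q_generic N -> q_generic M.
Proof. by move=> MN [q0 H]; split=> // k /andP[k0 kM]; apply: H; rewrite k0 (leq_trans kM). Qed.

Lemma q_generic_inj (N : nat) (x y : int) : q_generic N ->
  (`|x - y| <= N)%N -> q ^ x = q ^ y -> x = y.
Proof.
move=> [q0 H] xyN e; apply/eqP; rewrite -subr_eq0.
have {e} : q ^ (x - y) = 1 by rewrite expfzDr // e -expfzDr // subrr.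
case: (x - y) xyN => [[|k]|k] //= kN; first by move/eqP; rewrite (negPf (H k.+1 _)).
by rewrite NegzE -exprnN => /eqP; rewrite invr_eq1 (negPf (H k.+1 _)).
Qed.

Definition wt (b : box) : C := q ^ HD b.

Lemma wt_neq0 (b : box) : q != 0 -> wt b != 0.
Proof. exact: expfz_neq0. Qed.

Definition apoly (D : seq box) : {poly C} := \prod_(b <- addable D) ('X - (wt b)%:P).
Definition cpoly (D : seq box) : {poly C} := \prod_(b <- corners D) ('X - (wt b)%:P).

(** Multiplicative form of [perm_addable_corners]: shifting a box by $(1,0)$, $(0,1)$, $(1,1)$
    multiplies its weight by $q$, $q^{-1}$, $1$. *)
Lemma content_identity (D : seq box) : q != 0 -> uniq D -> downclosed D ->
  apoly D * (\prod_(b <- D) ('X - (wt b)%:P)) ^+ 2 =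
  ('X - 1%:P) * (\prod_(b <- D) ('X - (q * wt b)%:P)) *
  (\prod_(b <- D) ('X - (wt b / q)%:P)) * cpoly D.
Proof.
move=> q0 uD dD.
have := perm_big _ (perm_addable_corners uD dD) (F := fun b => 'X - (wt b)%:P) (P := xpredT)
  (op := *%R) (x := 1).
rewrite /= big_cons !big_cat /= !big_map.
have e11 : (fun b => 'X - (wt (shift 1 1 b))%:P) =1 (fun b => 'X - (wt b)%:P).
  by move=> b; rewrite /wt /HD /= (_ : _ - _ = b.1%:Z - b.2%:Z) //; lia.
have e10 : (fun b => 'X - (wt (shift 1 0 b))%:P) =1 (fun b => 'X - (q * wt b)%:P).
  move=> b; rewrite /wt /HD /= (_ : (b.1 + 1)%N%:Z - _ = 1 + (b.1%:Z - b.2%:Z)) ?expfzDr //; lia.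
have e01 : (fun b => 'X - (wt (shift 0 1 b))%:P) =1 (fun b => 'X - (wt b / q)%:P).
  move=> b; rewrite /wt /HD /= (_ : _ - _ = (b.1%:Z - b.2%:Z) - 1) ?expfzDr //; lia.
rewrite !(eq_bigr _ (fun b _ => e11 b)) (eq_bigr _ (fun b _ => e10 b)).
rewrite (eq_bigr _ (fun b _ => e01 b)) /wt /HD subrr expr0z /apoly /cpoly expr2 => ->.
by rewrite !mulrA.
Qed.

Notation del D z := [seq x <- D | x != z].

Lemma perm_del (D : seq box) (z : box) : uniq D -> z \in D -> perm_eq D (z :: del D z).
Proof.
by move=> uD zD; rewrite (permPl (perm_to_rem zD)) perm_cons rem_filter.
Qed.

(** Cross-multiplied quotient of [content_identity] for [D] and for [D] without [z]: the
    contributions of the remaining boxes cancel and only those of [z] stay. *)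
Lemma content_del (D : seq box) (z : box) : q != 0 -> uniq D -> downclosed D ->
  z \in corners D ->
  apoly D * cpoly (del D z) * ('X - (wt z)%:P) ^+ 2 =
  apoly (del D z) * cpoly D * (('X - (q * wt z)%:P) * ('X - (wt z / q)%:P)).
Proof.
move=> q0 uD dD zc; have zD := corner_mem zc.
have := content_identity q0 (filter_uniq _ uD) (corner_remove dD zc).
have := content_identity q0 uD dD; rewrite !(perm_big _ (perm_del uD zD)) !big_cons /=.
set Q := \prod_(b <- _) ('X - (wt b)%:P); set A := apoly D; set A' := apoly _.
move=> e1 e2; have Q0 : Q ^+ 2 != 0.
  by rewrite expf_neq0 // /Q monic_neq0 // monic_prod // => i _; apply: monicXsubC.
apply: (mulIf Q0).
rewrite (_ : _ * _ * _ * _ = A * (('X - (wt z)%:P) * Q) ^+ 2 * cpoly (del D z)); last by ring.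
rewrite e1 (_ : _ * _ * _ * Q ^+ 2 = A' * Q ^+ 2 * cpoly D *
  (('X - (q * wt z)%:P) * ('X - (wt z / q)%:P))); last by ring.
by rewrite e2; ring.
Qed.

(** This is $d(b)$ of the overview. For distinct weights it is the residue of [cpoly] / [apoly] at
    [wt b], a q-analogue of Kerov's transition weights. *)
Definition transition (D : seq box) (b : box) : C :=
  \prod_(d <- corners D) (1 - q ^ (HD d - HD b)) /
  \prod_(b' <- addable D | b' != b) (1 - q ^ (HD b' - HD b)).

(** Its value at [wt b] is the derivative of [apoly] there, obtained without formal derivatives. *)
Definition adual (D : seq box) (b : box) : {poly C} :=
  \prod_(b' <- addable D | b' != b) ('X - (wt b')%:P).

Lemma apolyE (D : seq box) (b : box) : b \in addable D ->
  apoly D = ('X - (wt b)%:P) * adual D b.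
Proof. by move=> bA; rewrite /apoly (bigD1_seq b) //= uniq_addable. Qed.

Lemma transitionE (D : seq box) (b : box) : q != 0 -> uniq D -> downclosed D ->
  b \in addable D -> transition D b = (cpoly D).[wt b] / (adual D b).[wt b].
Proof.
move=> q0 uD dD bA; have v0 := wt_neq0 b q0.
have e d : 1 - q ^ (HD d - HD b) = (wt b - wt d) / wt b.
  by rewrite mulrBl divff // expfzDr // -invr_expz.
rewrite /transition /cpoly /adual !horner_prod.
under eq_bigr do rewrite e. under [X in _ / X]eq_bigr do rewrite e.
rewrite !prodf_div.
(* There is one corner fewer than addable boxes, so numerator and denominator carry the same power
   of [wt b]. *)
have -> : \prod_(b' <- addable D | b' != b) wt b = \prod_(d <- corners D) wt b.
  rewrite -big_filter -rem_filter ?uniq_addable // !big_const_seq !count_predT.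
  by rewrite size_rem // size_addable.
set c := \prod_(i <- _) wt b; have c0 : c != 0 by rewrite prodf_seq_neq0; apply/allP.
under [in RHS]eq_bigr do rewrite !hornerE. under [X in _ = _ / X]eq_bigr do rewrite !hornerE.
by rewrite invf_div mulrA divfK.
Qed.
End Contents.
Section Transition.
Variables (C : fieldType) (q : C) (D : seq box).
Hypotheses (uD : uniq D) (dD : downclosed D) (qD : q_generic q (size D).*2).

Let q0 : q != 0. Proof. by case: qD. Qed.

Lemma wt_eq (a b : box) : (`|HD a| <= size D)%N -> (`|HD b| <= size D)%N ->
  (wt q a == wt q b) = (HD a == HD b).
Proof.
move=> ha hb; apply/eqP/eqP; last by rewrite /wt => ->.
by apply: q_generic_inj qD _; clear -ha hb; lia.
Qed.

Lemma wt_addable_eq a b : a \in addable D -> b \in addable D ->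
  (wt q a == wt q b) = (a == b).
Proof.
move=> aA bA; rewrite wt_eq ?HD_addable_bound //.
by apply/eqP/eqP => [|->//]; apply: (addable_HD_inj dD).
Qed.

Lemma HD_corner_bound a : a \in corners D -> (`|HD a| <= size D)%N.
Proof. by move=> /corner_mem /(HD_bound dD) /ltnW. Qed.

Lemma wt_corner_eq a b : a \in corners D -> b \in corners D ->
  (wt q a == wt q b) = (a == b).
Proof.
move=> aA bA; rewrite wt_eq ?HD_corner_bound //.
by apply/eqP/eqP => [|->//]; apply: (corners_HD_inj dD).
Qed.

Lemma wt_corner_addable a b : a \in corners D -> b \in addable D ->
  wt q a != wt q b.
Proof.
move=> aA bA; rewrite (wt_eq (HD_corner_bound aA) (HD_addable_bound bA)).
exact/eqP/(corner_addable_HD dD aA bA).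
Qed.

Lemma adual_neq0 (b : box) : b \in addable D -> (adual q D b).[wt q b] != 0.
Proof.
move=> bA; rewrite horner_prod prodf_seq_neq0; apply/allP => a aA; apply/implyP => ab.
by rewrite !hornerE subr_eq0 wt_addable_eq // eq_sym.
Qed.

Lemma cpoly_neq0 (b : box) : b \in addable D -> (cpoly q D).[wt q b] != 0.
Proof.
move=> bA; rewrite horner_prod prodf_seq_neq0; apply/allP => a aA.
by rewrite !hornerE subr_eq0 eq_sym wt_corner_addable.
Qed.

Lemma transition_neq0 (b : box) : b \in addable D -> transition q D b != 0.
Proof. by move=> bA; rewrite transitionE // mulf_neq0 ?invr_eq0 ?cpoly_neq0 ?adual_neq0. Qed.

Lemma q_neq1 (b : box) : b \in D -> q != 1.
Proof.
move=> bD; have [_ /(_ 1%N)] := qD; rewrite expr1; apply.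
by case: (D) bD.
Qed.

End Transition.

Section TransitionStep.
Variables (C : fieldType) (q : C) (D : seq box) (z : box).
Hypotheses (uD : uniq D) (dD : downclosed D) (qD : q_generic q (size D).*2).
Hypothesis zc : z \in corners D.

Let q0 : q != 0. Proof. by case: qD. Qed.
Let D' := [seq x <- D | x != z].
Let uD' : uniq D'. Proof. exact: filter_uniq. Qed.
Let dD' : downclosed D'. Proof. exact: corner_remove. Qed.
Let qD' : q_generic q (size D').*2.
Proof. apply: q_generic_le qD; rewrite leq_double size_filter; exact: count_size. Qed.

(** Since [b] stays addable, both sides of [content_del] vanish at [wt b]; the common factor is
    cancelled before evaluating there. *)
Lemma transition_step (b : box) : b \in addable D -> ~~ collinear z b ->
  transition q D' b = (wt q b - q * wt q z) * (wt q b - wt q z / q) /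
                      (wt q b - wt q z) ^+ 2 * transition q D b.
Proof.
move=> bA nc; have bA' := corner_addableN dD zc bA nc.
rewrite !transitionE //.
have e := content_del q0 uD dD zc; rewrite (apolyE q bA) (apolyE q bA') in e.
have {e} /(congr1 (fun p => p.[wt q b])) : adual q D b * cpoly q D' * ('X - (wt q z)%:P) ^+ 2 =
  adual q D' b * cpoly q D * (('X - (q * wt q z)%:P) * ('X - (wt q z / q)%:P)).
  by apply: (mulfI (negbT (polyXsubC_eq0 (wt q b)))); rewrite !mulrA in e *.
rewrite !(hornerM, hornerXsubC, horner_exp) => e.
have v0 : wt q b - wt q z != 0 by rewrite subr_eq0 eq_sym (wt_corner_addable dD qD).
have a0 := adual_neq0 dD qD bA.
have a0' : (adual q D' b).[wt q b] != 0 by apply: adual_neq0.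
apply: (mulIf a0'); rewrite divfK //.
apply: (mulIf (mulf_neq0 a0 (expf_neq0 2 v0))).
rewrite mulrA [_ * (adual q D b).[_]]mulrC e.
by field; rewrite a0 v0.
Qed.

(** As [z] is a corner of [D] and addable to the smaller diagram, both sides of [content_del]
    contain $(X-v)^2$ with $v$ the weight of [z]. After division, $(X-qv)(X-v/q)$ at $X=v$ gives
    $(1-q)(1-q^{-1})v^2$. *)
Lemma transition_corner :
  transition q D' z = (1 - q) * (1 - q^-1) * wt q z ^+ 2 *
     (\prod_(d <- corners D | d != z) (wt q z - wt q d)) / (apoly q D).[wt q z].
Proof.
have zA := corner_addable dD zc.
rewrite !transitionE //.
have cE : cpoly q D = ('X - (wt q z)%:P) * \prod_(d <- corners D | d != z) ('X - (wt q d)%:P).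
  by rewrite /cpoly (bigD1_seq z) //= uniq_corners.
have e := content_del q0 uD dD zc; rewrite (apolyE q zA) cE in e.
have {e} /(congr1 (fun p => p.[wt q z])) : apoly q D * cpoly q D' =
  adual q D' z * (\prod_(d <- corners D | d != z) ('X - (wt q d)%:P)) *
  (('X - (q * wt q z)%:P) * ('X - (wt q z / q)%:P)).
  have X0 : ('X - (wt q z)%:P) ^+ 2 != 0 by rewrite expf_neq0 // polyXsubC_eq0.
  by apply: (mulIf X0); rewrite e; ring.
rewrite !(hornerM, hornerXsubC) [(\prod_(d <- corners D | _) _).[_]]horner_prod => e.
have a0' : (adual q D' z).[wt q z] != 0 by apply: adual_neq0.
have a0 : (apoly q D).[wt q z] != 0.
  rewrite horner_prod prodf_seq_neq0; apply/allP => a aA.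
  by rewrite !hornerE subr_eq0 (wt_corner_addable dD qD).
apply: (mulIf a0'); rewrite divfK //; apply: (mulfI a0); rewrite e.
have -> : \prod_(i <- corners D | i != z) ('X - (wt q i)%:P).[wt q z] =
          \prod_(d <- corners D | d != z) (wt q z - wt q d).
  by apply: eq_bigr => d _; rewrite hornerXsubC.
by field; rewrite q0 a0.
Qed.
End TransitionStep.

(** By [transition_corner] each summand becomes a value of [apoly] divided by differences of
    weights. For [b != b'], removing both roots from [apoly] leaves a monic polynomial of degree one
    less than the number of corners, so interpolation at the corners makes the sum cancel the 1. For
    [b = b'] only one root is removed and [wt b] is added as a node; its term is the right-hand
    side. *)
Lemma transition_sum (C : fieldType) (q : C) (D : seq box) (b b' : box) :
  uniq D -> downclosed D -> q_generic q (size D).*2 ->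
  b \in addable D -> b' \in addable D ->
  1 + (1 - q) ^+ 2 / q * \sum_(x <- corners D) wt q x ^+ 2 /
     ((wt q b - wt q x) * (wt q b' - wt q x) * transition q [seq y <- D | y != x] x)
  = (b == b')%:R / transition q D b.
Proof.
move=> uD dD qD bA bA'; have [q0 _] := qD.
pose P x := \prod_(d <- corners D | d != x) (wt q x - wt q d).
have P0 x : x \in corners D -> P x != 0.
  move=> xc; rewrite prodf_seq_neq0; apply/allP => a aA; apply/implyP => ab.
  by rewrite subr_eq0 (wt_corner_eq dD qD) // eq_sym.
have wP x : x \in corners D ->
    \prod_(y <- map (wt q) (corners D) | y != wt q x) (wt q x - y) = P x.
  move=> xc; rewrite big_map big_seq_cond [RHS]big_seq_cond; apply: eq_bigl => d.
  by case dc: (d \in corners D); rewrite //= (wt_corner_eq dD qD).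
have us : uniq (map (wt q) (corners D)).
  rewrite map_inj_in_uniq ?uniq_corners // => x y xc yc /eqP.
  by rewrite (wt_corner_eq dD qD) // => /eqP.
have vb x a : x \in corners D -> a \in addable D -> wt q x - wt q a != 0.
  by move=> xc aA; rewrite subr_eq0 (wt_corner_addable dD qD).
(* The sign arises from $(1-q)(1-q^{-1})=-(1-q)^2/q$. *)
have -> : (1 - q) ^+ 2 / q * \sum_(x <- corners D) wt q x ^+ 2 /
     ((wt q b - wt q x) * (wt q b' - wt q x) * transition q [seq y <- D | y != x] x) =
  - \sum_(x <- corners D) (apoly q D).[wt q x] / ((wt q x - wt q b) * (wt q x - wt q b') * P x).
  rewrite big_distrr -sumrN big_seq [RHS]big_seq; apply: eq_bigr => x xc /=.
  have q1 : 1 - q != 0 by rewrite subr_eq0 eq_sym (q_neq1 qD (corner_mem xc)).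
  have v0 := wt_neq0 x q0; have vb1 := vb _ _ xc bA; have vb1' := vb _ _ xc bA'.
  have a0 : (apoly q D).[wt q x] != 0.
    rewrite horner_prod prodf_seq_neq0; apply/allP => a aA.
    by rewrite !hornerE subr_eq0 (wt_corner_addable dD qD).
  have q1' : q - 1 != 0 by rewrite -oppr_eq0 opprB.
  rewrite transition_corner // -/(P x); have := P0 x xc.
  move: (P x) (wt q x) (wt q b) (wt q b') _.[_] v0 vb1 vb1' a0 => p v w w' a v0 vb1 vb1' a0 p0.
  have vb2 : w - v != 0 by rewrite -oppr_eq0 opprB.
  have vb2' : w' - v != 0 by rewrite -oppr_eq0 opprB.
  by field; rewrite v0 vb2 vb2' vb1 vb1' a0 p0 q0 q1 q1'.
have sA : count (fun a => a != b) (addable D) = size (corners D).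
  have := count_predC (pred1 b) (addable D).
  rewrite count_uniq_mem ?uniq_addable // bA size_addable // add1n => -[<-].
  exact: eq_count.
have [eb|nb] := eqVneq b b'; last first.
  rewrite mul0r; apply/eqP; rewrite subr_eq0 eq_sym; apply/eqP.
  pose G := \prod_(a <- addable D | (a != b) && (a != b')) ('X - (wt q a)%:P).
  have aG : apoly q D = ('X - (wt q b)%:P) * (('X - (wt q b')%:P) * G).
    rewrite (apolyE q bA) /adual -big_filter (bigD1_seq b') ?(filter_uniq _ (uniq_addable D)) //=.
      by rewrite big_filter_cond.
    by rewrite mem_filter eq_sym nb.
  have Gm : G \is monic by apply: monic_prod => y _; apply: monicXsubC.
  have sG : size G = size (map (wt q) (corners D)).
    rewrite /G -big_filter size_prod_XsubC size_map size_filter -sA.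
    have := count_predC (pred1 b') [seq a <- addable D | a != b].
    rewrite (count_uniq_mem _ (filter_uniq _ (uniq_addable D))).
    rewrite mem_filter (eq_sym b') nb bA' add1n.
    rewrite size_filter => <-; congr _.+1; rewrite count_filter; apply: eq_count => a /=.
    by rewrite andbC.
  rewrite -[RHS](lagrange_lead_coef us Gm sG) big_map big_seq [RHS]big_seq.
  apply: eq_bigr => x xc; rewrite wP // aG !hornerM !hornerXsubC.
  have := P0 x xc; have := vb _ _ xc bA; have := vb _ _ xc bA'.
  by move=> h1 h2 h3; field; rewrite h1 h2 h3.
rewrite -eb mul1r => {b' eb bA'}.
have Am : adual q D b \is monic by apply: monic_prod => y _; apply: monicXsubC.
pose s := wt q b :: map (wt q) (corners D).
have bs : wt q b \notin map (wt q) (corners D).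
  by apply/mapP => -[x xc /eqP]; rewrite eq_sym (negPf (wt_corner_addable dD qD xc bA)).
have sAd : size (adual q D b) = size s.
  by rewrite /adual -big_filter size_prod_XsubC /= size_map size_filter sA.
have us' : uniq s by rewrite /= bs.
have := lagrange_lead_coef us' Am sAd; rewrite big_cons => e.
have {e} : (adual q D b).[wt q b] / (cpoly q D).[wt q b] +
   \sum_(x <- corners D) (apoly q D).[wt q x] / ((wt q x - wt q b) * (wt q x - wt q b) * P x) = 1.
  rewrite -[RHS]e; congr (_ / _ + _).
    rewrite big_cons eqxx /= big_map horner_prod big_seq [RHS]big_seq_cond.
    apply: eq_big => [d|d _]; last by rewrite hornerXsubC.
    by case dc: (d \in corners D); rewrite //= (wt_corner_addable dD qD).
  rewrite big_map big_seq [RHS]big_seq; apply: eq_bigr => x xc.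
  rewrite /s big_cons eq_sym (wt_corner_addable dD qD) // wP // (apolyE q bA).
  rewrite hornerM hornerXsubC; have := P0 x xc; have := vb _ _ xc bA.
  by move=> h1 h2; field; rewrite h1 h2.
move=> e; rewrite transitionE // invf_div -{1}e addrK //.
Qed.
(** * Standard fillings *)

Section Swap.
Variables (T : Type) (x0 : T).

Definition tr (i k : nat) : nat := if k == i then i.+1 else if k == i.+1 then i else k.

Lemma trK i : involutive (tr i).
Proof. by move=> k; rewrite /tr; do ?case: eqP; lia. Qed.

Lemma size_swap (s : seq T) i : size (swap x0 s i) = size s.
Proof. by rewrite size_map size_iota. Qed.

Lemma nth_swap (s : seq T) i k : (k < size s)%N ->
  nth x0 (swap x0 s i) k = nth x0 s (tr i k).
Proof. by move=> ks; rewrite (nth_map 0%N) ?size_iota // nth_iota. Qed.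

Lemma tr_lt i k n : (i.+1 < n)%N -> (k < n)%N -> (tr i k < n)%N.
Proof. by rewrite /tr; do ?case: eqP; lia. Qed.

Lemma swapK (s : seq T) i : (i.+1 < size s)%N -> swap x0 (swap x0 s i) i = s.
Proof.
move=> i_s; apply: (@eq_from_nth _ x0); rewrite !size_swap // => k ks.
by rewrite !nth_swap ?size_swap ?tr_lt // trK.
Qed.

Lemma swap_rcons (s : seq T) x i : (i.+1 < size s)%N ->
  swap x0 (rcons s x) i = rcons (swap x0 s i) x.
Proof.
move=> i_s; apply: (@eq_from_nth _ x0); rewrite ?size_rcons !size_swap ?size_rcons // => k.
rewrite ltnS leq_eqVlt => /orP[/eqP->|ks].
  rewrite nth_swap ?size_rcons // /tr !gtn_eqF ?(ltnW i_s) //.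
  by rewrite !nth_rcons size_swap ltnn eqxx.
rewrite nth_swap ?size_rcons ?(leqW ks) // !nth_rcons size_swap ks tr_lt //.
by rewrite nth_swap.
Qed.

Lemma swap_rcons2 (s : seq T) x y :
  swap x0 (rcons (rcons s x) y) (size s) = rcons (rcons s y) x.
Proof.
apply: (@eq_from_nth _ x0); rewrite ?size_swap !size_rcons // => k ks.
rewrite nth_swap ?size_rcons //. rewrite !nth_rcons !size_rcons /tr.
have [->|k1] := eqVneq k (size s); first by rewrite !ltnn !eqxx ltnSn.
have [->|k2] := eqVneq k (size s).+1; first by rewrite ltnSn !ltnn eqxx.
have ks' : (k < size s)%N by lia.
by rewrite ks' (leqW ks').
Qed.
End Swap.

Lemma perm_swap (T : eqType) (x0 : T) (s : seq T) i : (i.+1 < size s)%N ->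
  perm_eq (swap x0 s i) s.
Proof.
elim/last_ind: s => // s x IH; rewrite size_rcons ltnS leq_eqVlt => /orP[/eqP|] i_s.
  case/lastP: s IH i_s => // s y _; rewrite size_rcons => -[->].
  rewrite swap_rcons2 -!cats1 -!catA perm_cat2l /=; apply/permP => a /=; lia.
by rewrite swap_rcons // -!cats1 perm_cat2r IH.
Qed.

(** A standard tableau as a growing chain of diagrams; the constructor exposes the largest label, on
    which the main induction runs. *)
Inductive standard_filling : seq box -> Prop :=
| Standard_nil : standard_filling [::]
| Standard_rcons W x : standard_filling W -> x \in addable W -> standard_filling (rcons W x).

Lemma standard_rconsE W x :
  standard_filling (rcons W x) <-> standard_filling W /\ x \in addable W.
Proof.
split=> [H|[]]; last exact: Standard_rcons.
move: {-1}(rcons W x) (erefl (rcons W x)) H => s es H.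
by case: H es => [|W' x' H1 H2] => [|/rcons_inj[-> ->]] //; case: (W).
Qed.

Lemma standard_uniq W : standard_filling W -> uniq W.
Proof. by elim=> // {}W x _ uW /addable_notin; rewrite rcons_uniq uW andbT. Qed.

Lemma standard_downclosed W : standard_filling W -> downclosed W.
Proof.
case=> // {}W x _; rewrite addableE => /andP[_ dW].
by rewrite (eq_downclosed (mem_rcons W x)).
Qed.

Lemma del_rcons (W : seq box) (z : box) : z \notin W -> [seq x <- rcons W z | x != z] = W.
Proof.
move=> zW; rewrite filter_rcons eqxx /=; apply/all_filterP/allP => x xW.
by apply: contraNneq zW => <-.
Qed.

Lemma standard_last_corner W z : standard_filling (rcons W z) -> z \in corners (rcons W z).
Proof.
move=> sWz; have [sW /addable_notin zW] := proj1 (standard_rconsE _ _) sWz.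
by rewrite mem_filter mem_rcons mem_head andbT /= del_rcons // standard_downclosed.
Qed.

(** When the two labels are the last ones, non-collinearity says that the later box was already
    addable before the earlier one was placed. *)
Lemma standard_swap (W : seq box) (i : nat) : standard_filling W -> (i.+1 < size W)%N ->
  ~~ collinear (nth (0,0)%N W i) (nth (0,0)%N W i.+1) -> standard_filling (swap (0,0)%N W i).
Proof.
move=> sW; elim: sW => // {}W x sW IH xW; rewrite size_rcons ltnS leq_eqVlt => /orP[/eqP|] i_s.
  case/lastP: W sW xW i_s {IH} => // W y sWy xW; rewrite size_rcons => -[->].
  rewrite !nth_rcons !size_rcons leqnn !ltnn !eqxx => nc.
  rewrite swap_rcons2; have [sW yW] := proj1 (standard_rconsE _ _) sWy.
  have yc := standard_last_corner sWy; have dW := standard_downclosed sW.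
  have xW' : x \in addable W.
    have := corner_addableN (standard_downclosed sWy) yc xW nc.
    by rewrite del_rcons ?addable_notin.
  apply: Standard_rcons; first exact: Standard_rcons.
  have dWx := standard_downclosed (Standard_rcons sW xW').
  case: y {sWy} yW nc yc xW => a b yW nc yc xW; rewrite addableP // !mem_rcons !inE.
  move: yW; rewrite addableP // => /and3P[yW y1 y2].
  rewrite (negPf yW) orbF; apply/and3P; split.
  - by apply: contra nc => /eqP ->; rewrite /collinear eqxx.
  - by case/orP: y1 => ->; rewrite ?orbT.
  - by case/orP: y2 => ->; rewrite ?orbT.
rewrite !nth_rcons i_s (ltnW i_s) => nc; rewrite swap_rcons //.
apply: Standard_rcons; first exact: IH.
rewrite (@eq_addable _ W) ?size_swap //; exact/perm_mem/perm_swap.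
Qed.
(** * The conjugation sum in J_(n+1) *)

Section FillingOperators.
Variables (C : fieldType) (al be : C) (eta : C -> C).
Notation q := (q al be).
Notation wt := (wt q).

(* Matrix entries of [hinv] when the two labels sit in boxes a and b; in the collinear case
   [inv_diag] still equals the generic expression, see [inv_diagE]. *)
Definition inv_diag (a b : box) : C :=
  (al * be)^-1 * (al + be - (if a.1 == b.1 then al else if a.2 == b.2 then be
                             else (al + be) / (1 - wt a / wt b))).
Definition inv_swap (a b : box) : C :=
  if collinear a b then 0 else - (al * be)^-1 * eta (wt a / wt b).

(* Operators act on functions of fillings: transposes of the operators on formal combinations,
   which avoids comparing formal sums as lists. *)
Definition Tinv (i : nat) (phi : seq box -> C) : seq box -> C := fun W =>
  let a := nth (0,0)%N W i in let b := nth (0,0)%N W i.+1 in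
  inv_diag a b * phi W + inv_swap a b * phi (swap (0,0)%N W i).

Lemma TinvE i phi W : Tinv i phi W =
  inv_diag (nth (0,0)%N W i) (nth (0,0)%N W i.+1) * phi W +
  inv_swap (nth (0,0)%N W i) (nth (0,0)%N W i.+1) * phi (swap (0,0)%N W i).
Proof. by []. Qed.

Definition move_last (b b' : box) (phi : seq box -> C) : seq box -> C := fun W =>
  (nth (0,0)%N W (size W).-1 == b)%:R * phi (set_nth (0,0)%N W (size W).-1 b').

Lemma move_last_rcons b b' phi W y :
  move_last b b' phi (rcons W y) = (y == b)%:R * phi (rcons W b').
Proof.
rewrite /move_last size_rcons nth_rcons ltnn eqxx; congr (_ * phi _).
by elim: W => //= x W <-.
Qed.

(** Transpose of $h_k^{-1}\cdots h_1^{-1}Xh_1^{-1}\cdots h_k^{-1}$. As $h_j$ exchanges the labels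
    $n-j$ and $n-j+1$, its zero-based position is $n-j-1$. *)
Fixpoint conj_inv (n k : nat) (X : (seq box -> C) -> seq box -> C) phi : seq box -> C :=
  if k is k'.+1 then Tinv (n - k'.+2) (conj_inv n k' X (Tinv (n - k'.+2) phi)) else X phi.

(** The innermost conjugation is absorbed into [X]; the remaining ones are those for [n] labels and
    leave the last entry of a filling of size [n.+1] alone. *)
Lemma conj_invS n k X phi :
  conj_inv n.+1 k.+1 X phi = conj_inv n k (fun f => Tinv n.-1 (X (Tinv n.-1 f))) phi.
Proof.
elim: k phi => [|k IH] phi.
  by rewrite /= (_ : (n.+1 - 2)%N = n.-1) //; lia.
rewrite [LHS](_ : _ = Tinv (n.+1 - k.+3) (conj_inv n.+1 k.+1 X (Tinv (n.+1 - k.+3) phi))) //.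
by rewrite IH subSS.
Qed.

Definition conj_sum (n : nat) X phi W : C :=
  \sum_(k < n) (- (al * be)) ^+ k * conj_inv n k X phi W.

Lemma conj_sumS n X phi W : conj_sum n.+1 X phi W =
  X phi W + - (al * be) * conj_sum n (fun f => Tinv n.-1 (X (Tinv n.-1 f))) phi W.
Proof.
rewrite /conj_sum big_ord_recl expr0 mul1r; congr (_ + _).
by rewrite big_distrr; apply: eq_bigr => k _; rewrite lift0 exprS -mulrA conj_invS.
Qed.

(** Replaces equality of test functions by agreement on fillings of the relevant size, the only
    place where [Tinv_rcons] and [dual_hinv] give equalities. *)
Definition extensional_at (n : nat) (X : (seq box -> C) -> seq box -> C) :=
  forall f g, (forall V, size V = n -> f V = g V) ->
  forall V, size V = n -> X f V = X g V.

Lemma Tinv_ext n i : extensional_at n (Tinv i).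
Proof. by move=> f g fg V sV; rewrite /Tinv !fg ?size_swap. Qed.

Lemma move_last_ext n b b' : (0 < n)%N -> extensional_at n (move_last b b').
Proof. by move=> n0 f g fg V sV; rewrite /move_last fg // size_set_nth sV; lia. Qed.

Lemma conj_inv_ext n k X : extensional_at n X -> extensional_at n (conj_inv n k X).
Proof.
move=> eX; elim: k => [|k IH] // f g fg V sV /=.
by apply: Tinv_ext sV => {}V sV; apply: IH sV => {}V sV; apply: Tinv_ext sV.
Qed.

Lemma Tinv_rcons i phi W z : (i.+1 < size W)%N ->
  Tinv i phi (rcons W z) = Tinv i (fun V => phi (rcons V z)) W.
Proof. by move=> iW; rewrite /Tinv !nth_rcons iW (ltnW iW) swap_rcons. Qed.

(** An entry of [r] records a coefficient, the source and target of the moved label, and the box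
    finally appended. The remaining conjugations do not see the last entry, so they commute with
    appending. The hypothesis ranges over all standard orderings of [D] because the swaps reorder
    [W]. *)
Lemma conj_inv_lift (D : seq box) (z : box) Y (r : seq (C * (box * box) * box)) :
  (forall phi W, standard_filling W -> perm_eq W D ->
    Y phi (rcons W z) = \sum_(j <- r) j.1.1 *
       move_last j.1.2.1 j.1.2.2 (fun V => phi (rcons V j.2)) W) ->
  forall k phi W, (k < size D)%N -> standard_filling W -> perm_eq W D ->
    conj_inv (size D) k Y phi (rcons W z) = \sum_(j <- r) j.1.1 *
       conj_inv (size D) k (move_last j.1.2.1 j.1.2.2) (fun V => phi (rcons V j.2)) W.
Proof.
move=> HY; elim=> [|k IH] phi W kD sW pW; first exact: HY.
rewrite [LHS]/=; set i := (size D - k.+2)%N.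
have sz := perm_size pW; have iW : (i.+1 < size W)%N by rewrite sz /i -subSn // subSS ltn_subrL /= (leq_trans _ kD).
rewrite {1}/Tinv !nth_rcons iW (ltnW iW) swap_rcons // IH ?(ltnW kD) //.
set a := nth _ W i; set b := nth _ W i.+1.
have -> : inv_swap a b * conj_inv (size D) k Y (Tinv i phi) (rcons (swap (0%N, 0%N) W i) z) =
  inv_swap a b * \sum_(j <- r) j.1.1 *
       conj_inv (size D) k (move_last j.1.2.1 j.1.2.2) (fun V => Tinv i phi (rcons V j.2))
       (swap (0%N, 0%N) W i).
  have [cab|nab] := boolP (collinear a b); first by rewrite /inv_swap cab !mul0r.
  rewrite IH ?(ltnW kD) //; first exact: standard_swap.
  by rewrite (perm_trans _ pW) // perm_swap.
rewrite !big_distrr -big_split; apply: eq_bigr => j _ /=.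
rewrite -/i.
have e V : size V = size D -> conj_inv (size D) k (move_last j.1.2.1 j.1.2.2)
    (fun V => Tinv i phi (rcons V j.2)) V = conj_inv (size D) k (move_last j.1.2.1 j.1.2.2)
    (Tinv i (fun V => phi (rcons V j.2))) V.
  move=> sV; apply: conj_inv_ext sV; first by apply: move_last_ext; lia.
  by move=> {}V sV; rewrite Tinv_rcons // sV -sz.
rewrite !e ?size_swap //; set G := conj_inv _ _ _ _.
by rewrite [X in _ = _ * X]/Tinv -/a -/b; ring.
Qed.

(** The guard [0 < size D] is there because for the empty diagram the sum is empty, while the
    expansion of [Y] needs a second-to-last box. *)
Lemma conj_sum_lift (D : seq box) (z : box) Y (r : seq (C * (box * box) * box)) :
  ((0 < size D)%N -> forall phi W, standard_filling W -> perm_eq W D ->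
    Y phi (rcons W z) = \sum_(j <- r) j.1.1 *
       move_last j.1.2.1 j.1.2.2 (fun V => phi (rcons V j.2)) W) ->
  forall phi W, standard_filling W -> perm_eq W D ->
    conj_sum (size D) Y phi (rcons W z) = \sum_(j <- r) j.1.1 *
       conj_sum (size D) (move_last j.1.2.1 j.1.2.2) (fun V => phi (rcons V j.2)) W.
Proof.
move=> HY phi W sW pW; rewrite /conj_sum.
under [RHS]eq_bigr do rewrite big_distrr.
rewrite exchange_big; apply: eq_bigr => k _ /=.
have D0 : (0 < size D)%N by apply: leq_ltn_trans (ltn_ord k).
rewrite (conj_inv_lift (HY D0)) // big_distrr; apply: eq_bigr => j _ /=; ring.
Qed.
End FillingOperators.
Lemma sum_move_last (C : fieldType) (s : seq box) (f : box -> C) (g : box -> box)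
  (phi : box -> seq box -> C) (V : seq box) (y : box) : uniq s -> y \in s ->
  \sum_(x <- s) f x * move_last x (g x) (phi x) (rcons V y) = f y * phi y (rcons V (g y)).
Proof.
move=> us ys; rewrite (bigD1_seq y) //= move_last_rcons eqxx mul1r big1 ?addr0 // => x xy.
by rewrite move_last_rcons eq_sym (negPf xy) mul0r mulr0.
Qed.

Section ConjSum.
Variables (C : fieldType) (al be : C) (eta : C -> C).
Hypotheses (al0 : al != 0) (be0 : be != 0).
Hypothesis etaP : forall x, x != 0 -> x != 1 -> eta x * eta x^-1 = - (al * be) * F al be x.
Notation q := (q al be).
Notation wt := (wt q).
Notation inv_diag := (inv_diag al be).
Notation inv_swap := (inv_swap al be eta).
Notation Tinv := (Tinv al be eta).
Notation conj_sum := (conj_sum al be eta).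

Let q0 : q != 0. Proof. by rewrite mulf_neq0 ?oppr_eq0 ?invr_eq0. Qed.

Lemma Tinv_rcons2 phi W y z : Tinv (size W) phi (rcons (rcons W y) z) =
  inv_diag y z * phi (rcons (rcons W y) z) + inv_swap y z * phi (rcons (rcons W z) y).
Proof. by rewrite /Tinv !nth_rcons !size_rcons leqnn !ltnn !eqxx swap_rcons2. Qed.

(** For weight ratio $q$ the generic entry $(\alpha+\beta)/(1-q)$ equals $\alpha$, for $q^{-1}$ it
    equals $\beta$, so all three branches agree. *)
Lemma inv_diagE (a b : box) : q != 1 -> wt a != wt b ->
  (a.1 = b.1 -> wt a = q * wt b) -> (a.1 <> b.1 -> a.2 = b.2 -> wt b = q * wt a) ->
  inv_diag a b = - (al + be) / (al * be) * (wt a / (wt b - wt a)).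
Proof.
move=> q1 ab h1 h2; rewrite /inv_diag.
have albe : al + be != 0.
  apply: contraNneq q1 => /eqP; rewrite addr_eq0 => /eqP ->.
  by rewrite /Defs.q divff // oppr_eq0.
have a0 := wt_neq0 a q0; have b0 := wt_neq0 b q0.
have ba : wt b - wt a != 0 by rewrite subr_eq0 eq_sym.
case: eqP => [/h1 e|/h2 e2].
  rewrite e; move: (wt b) b0 => w b0; rewrite /Defs.q; field.
  by rewrite al0 be0 (_ : w * al - - be * w = (al + be) * w) ?mulf_neq0 //; ring.
case: eqP => [/e2 e|_].
  rewrite e; move: (wt a) a0 => w a0; rewrite /Defs.q; field.
  by rewrite al0 be0 (_ : - be * w + - w * al = - (al + be) * w) ?mulf_neq0 ?oppr_eq0 //; ring.
by field; rewrite al0 be0 b0 ba.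
Qed.

Lemma inv_diag_corner (D : seq box) (z b : box) : downclosed D ->
  q_generic q (size D).*2 -> z \in corners D -> b \in addable D ->
  inv_diag z b = - (al + be) / (al * be) * (wt z / (wt b - wt z)).
Proof.
move=> dD qD zc bA; apply: inv_diagE.
- exact: (q_neq1 qD (corner_mem zc)).
- exact: (wt_corner_addable dD qD).
- move=> e; case: (corner_addable_collinear dD zc bA); first by rewrite /collinear e eqxx.
    by case=> h _; rewrite /wt h expfzDr // mulrCA divff ?mulr1.
  case=> _ h; case/negP: (addable_notin bA).
  by rewrite (surjective_pairing b) -e -h -surjective_pairing corner_mem.
move=> ne e; case: (corner_addable_collinear dD zc bA); first by rewrite /collinear e eqxx orbT.
  by case.
by case=> h _; rewrite /wt h expfzDr // mulrC.
Qed.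

Lemma inv_swap_sym (a b : box) : wt a != wt b -> ~~ collinear a b ->
  - (al * be) * (inv_swap a b * inv_swap b a) = F al be (wt a / wt b).
Proof.
move=> ab nc; have a0 := wt_neq0 a q0; have b0 := wt_neq0 b q0.
rewrite /inv_swap (collinearC b) (negPf nc) -[wt b / wt a]invf_div.
have := etaP (x := wt a / wt b); rewrite mulf_neq0 ?invr_eq0 // => /(_ isT).
have -> : wt a / wt b != 1.
  by apply: contra ab => /eqP e; rewrite -[wt a](divfK b0) e mul1r.
move=> /(_ isT) e; rewrite mulrACA e; field; by rewrite al0 be0.
Qed.

Lemma FE (x : C) : F al be x = (1 - x * q) * (1 - x / q) / (1 - x) ^+ 2.
Proof.
rewrite /F /Defs.q; congr (_ * _ / _); first by rewrite mulNr mulrN opprK mulrA.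
by rewrite mulNr invrN invf_div mulrN opprK mulrA.
Qed.

(* Peel off the last box z. If z <> b the two corners do not interact except through one
   factor F, which [transition_step] absorbs; if z = b the induction hypothesis yields a sum
   over the corners of the remaining shape, evaluated by [transition_sum]. *)
Lemma conj_sum_move_last (W : seq box) : standard_filling W ->
  q_generic q (size W).*2 -> forall b b' phi, b \in corners W ->
  b' \in addable [seq x <- W | x != b] ->
  conj_sum (size W) (move_last b b') phi W =
    (b == b')%:R * phi W / transition q [seq x <- W | x != b] b.
Proof.
elim=> // {}W z sW IH zA qWz b b' phi bc b'A.
have sWz := Standard_rcons sW zA; have zW := addable_notin zA.
have dWz := standard_downclosed sWz; have uWz := standard_uniq sWz.
have dW := standard_downclosed sW; have uW := standard_uniq sW.
have qW : q_generic q (size W).*2.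
  by apply: q_generic_le qWz; rewrite leq_double size_rcons.
rewrite size_rcons conj_sumS move_last_rcons.
have [zb|zb] := eqVneq z b.
  rewrite -{b}zb in bc b'A *; rewrite mul1r.
  rewrite del_rcons // in b'A *.
  (* On a filling ending in [x], [z], only the diagonal part of the first [Tinv] leaves [z] last,
     where it moves to [b']. The second [Tinv] then keeps [x], [b'] or exchanges them, giving the
     two families. *)
  pose r := [seq (inv_diag x z * inv_diag x b', (x, x), b') | x <- corners W] ++
            [seq (inv_diag x z * inv_swap x b', (x, b'), x) | x <- corners W].
  rewrite (@conj_sum_lift _ _ _ _ W z _ r) //; last first.
    move=> W0 {}phi V sV pV; rewrite -(perm_size pV) in W0 *.
    case/lastP: V W0 sV pV => // V y _ sVy pV; rewrite size_rcons /=.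
    have yc : y \in corners W.
      by rewrite -(perm_mem (perm_corners pV)) standard_last_corner.
    have yz : y != z by apply: contraNneq zW => <-; apply: corner_mem.
    rewrite Tinv_rcons2 !move_last_rcons eqxx (negPf yz) mul1r mul0r mulr0 addr0 Tinv_rcons2.
    rewrite big_cat !big_map /=.
    by rewrite !sum_move_last ?uniq_corners // mulrDr !mulrA.
  rewrite big_cat !big_map /=.
  (* The exchanged family moves a label from the corner [x] to [b'], which lies outside [W]; by
     induction this contributes 0. *)
  rewrite [X in _ * (_ + X)]big1_seq ?addr0; last first.
    move=> x /andP[_ xc]; have [c|nc] := boolP (collinear x b').
      by rewrite /inv_swap c mulr0 mul0r.
    rewrite IH ?(corner_addableN dW xc b'A) //.
    have -> : x == b' = false.
      by apply/negbTE; apply: contraNneq (addable_notin b'A) => <-; apply: corner_mem.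
    by rewrite !mul0r mulr0.
  have e1 : (z == b')%:R * phi (rcons W z) = (z == b')%:R * phi (rcons W b').
    by case: eqP => [->|_] //; rewrite !mul0r.
  (* The prefactor of [transition_sum] is matched by
     $-\alpha\beta\,((\alpha+\beta)/(\alpha\beta))^2=(1-q)^2/q$. *)
  rewrite e1 mulrAC -(transition_sum uW dW qW zA b'A) mulrDl mul1r; congr (_ + _).
  rewrite !big_distrr big_distrl big_seq [RHS]big_seq; apply: eq_bigr => x xc /=.
  have xA := corner_addable dW xc.
  rewrite IH // eqxx mul1r (inv_diag_corner dW qW xc zA) (inv_diag_corner dW qW xc b'A).
  have t0 : transition q [seq y <- W | y != x] x != 0.
    apply: transition_neq0; rewrite ?filter_uniq ?corner_remove //.
    by apply: q_generic_le qW; rewrite leq_double size_filter count_size.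
  have := wt_corner_addable dW qW xc zA; have := wt_corner_addable dW qW xc b'A.
  rewrite ![wt x == _]eq_sym -!(subr_eq0 _ (wt x)).
  move: (transition _ _ _) t0 (wt x) (wt z) (wt b') => t t0 w v v' h1 h2.
  rewrite /Defs.q; field.
  by rewrite al0 oppr_eq0 be0 h1 h2 t0.
rewrite mul0r add0r.
have bcW : b \in corners W.
  case: b bc zb {b'A} => i j; rewrite !cornersE // !mem_rcons !inE.
  move=> /and3P[] /orP[/eqP->|]; first by rewrite eqxx.
  by move=> -> ; rewrite !negb_or => /andP[_ ->] /andP[_ ->].
have nbz : ~~ collinear b z.
  by apply: (corners_not_collinear dWz bc); rewrite ?(standard_last_corner sWz) 1?eq_sym.
have zA' := corner_addableN dW bcW zA nbz.
set nu := [seq x <- rcons W z | x != b]; have nuE : nu = rcons [seq x <- W | x != b] z.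
  by rewrite /nu filter_rcons zb.
have dnu : downclosed nu := corner_remove dWz bc.
have unu : uniq nu := filter_uniq _ uWz.
have bA : b \in addable nu := corner_addable dWz bc.
have qnu : q_generic q (size nu).*2.
  by apply: q_generic_le qWz; rewrite leq_double size_filter count_size.
have znu : z \in corners nu.
  rewrite nuE in dnu *; rewrite mem_filter mem_rcons mem_head andbT.
  rewrite del_rcons ?addable_notin //; exact: corner_remove dW bcW.
have nuz : [seq x <- nu | x != z] = [seq x <- W | x != b].
  by rewrite nuE del_rcons ?addable_notin.
(* Now [b] must first be exchanged with [z] to become last, hence the common factor [inv_swap b z].
   The first term moves [b] to [z] and vanishes by induction, as these boxes differ. *)
pose r := [:: (inv_swap b z * inv_diag z b', (b, z), b');
              (inv_swap b z * inv_swap z b', (b, b'), z)].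
rewrite (@conj_sum_lift _ _ _ _ W z _ r) //; last first.
  move=> W0 {}phi V sV pV; rewrite -(perm_size pV) in W0 *.
  case/lastP: V W0 sV pV => // V y _ sVy pV; rewrite size_rcons /=.
  rewrite Tinv_rcons2 !move_last_rcons (negPf zb) mul0r mulr0 add0r.
  rewrite !big_cons big_nil /= !move_last_rcons Tinv_rcons2 addr0.
  have [->|_] := eqVneq y b; last by rewrite !mul0r !mulr0 addr0.
  by rewrite !mul1r mulrDr !mulrA.
rewrite !big_cons big_nil /= addr0 IH // eq_sym (negPf zb) !mul0r mulr0 add0r.
have [c|nc] := boolP (collinear z b').
  rewrite {2}/inv_swap c mulr0 mul0r mulr0.
  have -> : b == b' = false; last by rewrite !mul0r.
  by apply: contraNF nbz => /eqP ->; rewrite collinearC.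
have b'A' : b' \in addable [seq x <- W | x != b].
  by rewrite -nuz; apply: corner_addableN.
rewrite IH //; have [eb|_] := eqVneq b b'; last by rewrite !mul0r !mulr0.
rewrite -eb in nc *; rewrite !mul1r.
have wbz : wt b != wt z.
  by rewrite (wt_corner_eq dWz qWz) ?(standard_last_corner sWz) 1?eq_sym.
(* Exchanging [b] with [z] and back costs exactly $F$ of the weight ratio, which is the factor
   relating the two transition weights of [b] when the corner [z] is removed from [nu]. *)
rewrite [LHS]mulrA inv_swap_sym // -nuz (transition_step unu dnu qnu znu bA nc).
have t0 : transition q [seq x <- nu | x != z] b != 0.
  apply: transition_neq0; rewrite ?filter_uniq ?corner_remove //.
    by apply: q_generic_le qnu; rewrite leq_double [size (filter _ _)]size_filter count_size.
  by rewrite nuz [X in X \in _]eb.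
have := t0; rewrite (transition_step unu dnu qnu znu bA nc).
set X := _ / _; set t := transition _ _ _; rewrite mulf_eq0 negb_or => /andP[X0 t1].
have -> : F al be (wt b / wt z) = X.
  rewrite FE /X; have := wt_neq0 z q0.
  move: wbz; rewrite -subr_eq0; move: (wt b) (wt z) q0 => v w; move: q => p p0 vw w0.
  have wv : w - v != 0 by rewrite -oppr_eq0 opprB.
  by field; rewrite p0 vw w0 wv.
by clearbody X t; field; rewrite X0 t1.
Qed.
End ConjSum.
(** * Jucys-Murphy elements on standard triples *)

Section Dual.
Variable C : fieldType.
Implicit Types (A B : op C) (phi : triple -> C).

(** Pairs the formal combination [A t] with a test function, so order and repetition of terms become
    irrelevant; composition is reversed. Indicator functions recover coefficients in [coef_dual]. *)
Definition dual A phi : triple -> C := fun t => \sum_(p <- A t) p.1 * phi p.2.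

Lemma eq_dual A phi psi t : phi =1 psi -> dual A phi t = dual A psi t.
Proof. by move=> e; apply: eq_bigr => p _; rewrite e. Qed.

Lemma dual_comp A B phi t : dual (opcomp A B) phi t = dual B (dual A phi) t.
Proof.
rewrite /dual /opcomp /vapply big_flatten big_map; apply: eq_bigr => p _.
by rewrite big_map big_distrr; apply: eq_bigr => s _ /=; rewrite mulrA.
Qed.

Lemma dual_add A B phi t : dual (opadd A B) phi t = dual A phi t + dual B phi t.
Proof. by rewrite /dual big_cat. Qed.

Lemma dual_scale c A phi t : dual (opscale c A) phi t = c * dual A phi t.
Proof. by rewrite /dual big_map big_distrr; apply: eq_bigr => p _ /=; rewrite mulrA. Qed.

Lemma dual_id phi t : dual (@opid C) phi t = phi t.
Proof. by rewrite /dual big_seq1 mul1r. Qed.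

Lemma dual_sum (As : seq (op C)) phi t :
  dual (foldr (@opadd C) (@opzero C) As) phi t = \sum_(A <- As) dual A phi t.
Proof.
elim: As => [|A As IH] /=; first by rewrite big_nil /dual big_nil.
by rewrite dual_add IH big_cons.
Qed.

Lemma dual_comp_rcons As A phi t :
  dual (foldr (@opcomp C) (@opid C) (rcons As A)) phi t =
  dual A (dual (foldr (@opcomp C) (@opid C) As) phi) t.
Proof.
elim: As phi t => [|B As IH] phi t /=.
  by rewrite dual_comp dual_id; apply: eq_dual => s; rewrite dual_id.
by rewrite dual_comp IH; apply: eq_dual => s; rewrite dual_comp.
Qed.

Lemma coef_dual A t t' : coef (A t) t' = dual A (fun s => (s == t')%:R) t.
Proof.
rewrite /coef /dual big_mkcond; apply: eq_bigr => p _.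
by case: eqP; rewrite ?mulr1 ?mulr0.
Qed.
End Dual.

Lemma iota_rcons i k : iota i k.+1 = rcons (iota i k) (i + k)%N.
Proof. by rewrite -addn1 iotaD cats1. Qed.

Section DualJn1.
Variables (C : fieldType) (al be ka th : C) (eta : C -> C) (n : nat).
Notation q := (q al be).
Notation Tinv := (Tinv al be eta).
Notation hinv := (hinv al be th eta n).
Notation hinvL := (hinvL al be th eta n).
Notation hinvR := (hinvR al be th eta n).
Notation E := (Eop al be ka th n).

Lemma dual_hinv k phi BS W : (0 < k < n)%N -> size W = n ->
  dual (hinv k) phi (BS, W) = Tinv (n - k.+1) (fun V => phi (BS, V)) W.
Proof.
move=> /andP[k0 kn] sW; rewrite /hinv dual_scale dual_add !dual_scale dual_id.
rewrite /h /dual /hW /mu /= (_ : (n - k).-1 = n - k.+1)%N; last by rewrite subnS.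
have -> : (n - k < n)%N by lia.
have -> : (n - k.+1 < n)%N by lia.
have e : (n - k = (n - k.+1).+1)%N by lia.
rewrite /Tinv /inv_diag /inv_swap /collinear -e.
case: eqP => _; first by rewrite big_seq1 /=; ring.
case: eqP => _; first by rewrite big_seq1 /=; ring.
by rewrite big_cons big_seq1 /wt /=; ring.
Qed.

Lemma dual_hinvL k phi t : dual (hinvL k.+1) phi t = dual (hinvL k) (dual (hinv k.+1) phi) t.
Proof. by rewrite /hinvL iota_rcons add1n rev_rcons /= dual_comp. Qed.

Lemma dual_hinvR k phi t : dual (hinvR k.+1) phi t = dual (hinv k.+1) (dual (hinvR k) phi) t.
Proof.
by rewrite /hinvR iota_rcons add1n map_rcons dual_comp_rcons.
Qed.

(** The coefficients of [E] depend on [W] only through its set of boxes. Fixing [D] while [W] runs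
    over its reorderings lets them be pulled out of all the conjugations. *)
Lemma dual_conj_E (D : seq box) BS (b0 : box) : nth (true, (0,0)%N) BS 0 = (false, b0) ->
  size D = n -> forall k phi W, perm_eq W D -> (k < n)%N ->
  dual (hinvR k) (dual E (dual (hinvL k) phi)) (BS, W) =
  \sum_(b <- addable [seq x <- D | x != b0]) Defs.coefE al be ka th b0 [seq x <- D | x != b0] b *
    conj_inv al be eta n k (move_last b0 b)
      (fun V => phi (set_nth (true, (0,0)%N) BS 0 (false, b), V)) W.
Proof.
move=> hBS sD; elim=> [|k IH] phi W pW kn.
  rewrite dual_id; have sW := perm_size pW.
  have pd := perm_filter (fun x => x != b0) pW.
  rewrite /dual /Eop /= hBS /= eq_sym.
  rewrite /move_last sW sD; case: eqP => [_|_]; last first.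
    by rewrite big_nil big1 // => b _; rewrite mul0r mulr0.
  rewrite big_map (@eq_addable _ [seq x <- D | x != b0]) ?(perm_size pd) //; last first.
    exact: perm_mem.
  apply: eq_bigr => b _; rewrite mul1r [in LHS]/=; congr (_ * _).
    rewrite /Defs.coefE (@eq_addable _ [seq x <- D | x != b0]) ?(perm_size pd) //; last exact: perm_mem.
    by rewrite (perm_big _ (perm_corners pd)).
  by rewrite big_seq1 mul1r.
have sW : size W = n by rewrite (perm_size pW).
rewrite dual_hinvR dual_hinv //=.
have step V : perm_eq V D -> dual (hinvR k) (dual E (dual (hinvL k.+1) phi)) (BS, V) =
  \sum_(b <- addable [seq x <- D | x != b0]) Defs.coefE al be ka th b0 [seq x <- D | x != b0] b *
    conj_inv al be eta n k (move_last b0 b)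
      (Tinv (n - k.+2) (fun V => phi (set_nth (true, (0,0)%N) BS 0 (false, b), V))) V.
  move=> pV; rewrite (@eq_dual _ _ _ (dual E (dual (hinvL k) (dual (hinv k.+1) phi)))); last first.
    by move=> t; apply: eq_dual => s; rewrite dual_hinvL.
  rewrite IH ?(ltnW kn) //; apply: eq_bigr => b _; congr (_ * _).
  apply: (@conj_inv_ext _ _ _ _ n); last by rewrite (perm_size pV).
    by apply: move_last_ext; apply: leq_ltn_trans kn.
  by move=> U sU; rewrite dual_hinv.
rewrite {1}/Tinv !step //; last by rewrite (perm_trans _ pW) // perm_swap //; lia.
rewrite !big_distrr -big_split; apply: eq_bigr => b _ /=.
by set G := conj_inv _ _ _ _ _ _ _; rewrite TinvE; ring.
Qed.

Lemma dual_hinvR_vanish BS k psi W : (k < n)%N -> size W = n ->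
  (forall V, psi (BS, V) = 0) -> dual (hinvR k) psi (BS, W) = 0.
Proof.
move=> kn sW psi0; elim: k kn W sW => [|k IH] kn W sW; first by rewrite dual_id.
rewrite dual_hinvR dual_hinv // /Tinv !IH ?size_swap ?(ltnW kn) //.
by rewrite !mulr0 addr0.
Qed.

Lemma dual_Jn1 phi t : dual (Jn1 al be ka th eta n) phi t =
  phi t - (al + be) * ka * \sum_(k < n) (- (al * be)) ^+ k *
     dual (hinvR k) (dual E (dual (hinvL k) phi)) t.
Proof.
rewrite /Jn1 dual_add dual_id dual_scale dual_sum big_map mulNr; congr (_ - _ * _).
rewrite (iotaDl 1 0) big_map -[X in iota 0 X]subn0 -/(index_iota 0 n) big_mkord.
by apply: eq_bigr => k _; rewrite dual_scale !dual_comp add1n.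
Qed.

Lemma dual_Jn1_B phi BS W b : nth (true, (0,0)%N) BS 0 = (true, b) -> size W = n ->
  dual (Jn1 al be ka th eta n) phi (BS, W) = phi (BS, W).
Proof.
move=> hBS sW; rewrite dual_Jn1 big1 ?mulr0 ?subr0 // => k _.
by rewrite dual_hinvR_vanish ?mulr0 // => V; rewrite /dual /Eop /= hBS big_nil.
Qed.

(** Only the target [b' = b] survives [conj_sum_move_last], and its value $1/d(b)$ cancels $d(b)$ in
    the coefficient of [E]; what is left is $1-(1+\theta q^{-\mathrm{HD}(b)})$. *)
Lemma dual_Jn1_S phi BS W b : nth (true, (0,0)%N) BS 0 = (false, b) -> BS != [::] ->
  al != 0 -> be != 0 -> ka != 0 ->
  (forall x, x != 0 -> x != 1 -> eta x * eta x^-1 = - (al * be) * F al be x) ->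
  standard_filling W -> size W = n -> q_generic q n.*2 -> b \in corners W ->
  dual (Jn1 al be ka th eta n) phi (BS, W) = - th * q ^ (- HD b) * phi (BS, W).
Proof.
move=> hBS BS0 al0 be0 ka0 etaP sW szW qn bc; rewrite dual_Jn1.
set nu := [seq x <- W | x != b].
have uW := standard_uniq sW; have dW := standard_downclosed sW.
have bA : b \in addable nu by apply: corner_addable.
have -> : \sum_(k < n) (- (al * be)) ^+ k * dual (hinvR k) (dual E (dual (hinvL k) phi)) (BS, W) =
  \sum_(b' <- addable nu) Defs.coefE al be ka th b nu b' *
    conj_sum al be eta n (move_last b b')
      (fun V => phi (set_nth (true, (0,0)%N) BS 0 (false, b'), V)) W.
  under [RHS]eq_bigr do rewrite /conj_sum big_distrr.
  rewrite exchange_big; apply: eq_bigr => k _ /=.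
  rewrite (dual_conj_E hBS szW) // big_distrr; apply: eq_bigr => b' _ /=; ring.
have al_be0 : al + be != 0.
  have := q_neq1 (D := W) _ (corner_mem bc); rewrite szW => /(_ _ _ qn).
  by apply: contra => /eqP/(canRL (addrK _)); rewrite add0r => ->; rewrite /Defs.q divff ?oppr_eq0.
have t0 : transition q nu b != 0.
  apply: transition_neq0; rewrite ?filter_uniq ?corner_remove //.
  by apply: q_generic_le qn; rewrite leq_double -szW size_filter count_size.
rewrite (bigD1_seq b) ?uniq_addable //= big1_seq ?addr0; last first.
  move=> b' /andP[bb' b'A]; rewrite -szW conj_sum_move_last ?szW //.
  by rewrite eq_sym (negPf bb') !mul0r mulr0.
rewrite -szW conj_sum_move_last ?szW // eqxx mul1r.
have -> : set_nth (true, (0%N, 0%N)) BS 0 (false, b) = BS by case: BS hBS BS0 => //= ? ? ->.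
rewrite /Defs.coefE -/(transition q nu b); move: (_ ^ _) => x.
by field; rewrite ka0 al_be0 t0.
Qed.
End DualJn1.

(** * Conjugating a diagonal operator by one generator *)

Section DiagonalStep.
Variables (C : fieldType) (al be : C) (M J' : op C) (t : triple) (a c : C).
Hypotheses (al0 : al != 0) (be0 : be != 0).
Let J := opscale (- (al * be))^-1 (opcomp M (opcomp J' M)).

Lemma dual_step phi : dual J phi t = (- (al * be))^-1 * dual M (dual J' (dual M phi)) t.
Proof. by rewrite /J dual_scale !dual_comp. Qed.

Lemma dual_step_scalar s phi : M t = [:: (s, t)] ->
  (forall psi, dual J' psi t = a * psi t) -> s ^+ 2 * a = - (al * be) * c ->
  dual J phi t = c * phi t.
Proof.
move=> Mt Jt e; rewrite dual_step {1}/dual Mt big_seq1 /= Jt /dual Mt big_seq1 /=.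
have -> : s * (a * (s * phi t)) = s ^+ 2 * a * phi t by ring.
by rewrite e -mulrA mulKf // oppr_eq0 mulf_neq0.
Qed.

(** With $A=(\alpha+\beta)c/(c-a)$ and $A'=(\alpha+\beta)a/(a-c)$ the off-diagonal part $Aa+A'c$
    vanishes, and the relation for $ZZ'$ turns $A^2a+cZZ'$ into $-\alpha\beta c$. *)
Lemma dual_step_swap t' Z Z' phi : a != 0 -> c != 0 -> a != c ->
  M t = [:: ((al + be) / (1 - a / c), t); (Z, t')] ->
  M t' = [:: ((al + be) / (1 - c / a), t'); (Z', t)] ->
  Z * Z' = - (al * be) * F al be (a / c) ->
  (forall psi, dual J' psi t = a * psi t) ->
  (forall psi, dual J' psi t' = c * psi t') ->
  dual J phi t = c * phi t.
Proof.
move=> a0 c0 ac Mt Mt' ZZ Jt Jt'; rewrite dual_step {1}/dual Mt big_cons big_seq1 /=.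
rewrite Jt Jt' /dual Mt Mt' !big_cons !big_nil /= !addr0.
have ca : c - a != 0 by rewrite subr_eq0 eq_sym.
have ac' : a - c != 0 by rewrite subr_eq0.
set A := _ / (1 - a / c); set A' := _ / (1 - c / a).
have -> : A * (a * (A * phi t + Z * phi t')) + Z * (c * (A' * phi t' + Z' * phi t)) =
  (A ^+ 2 * a + c * (Z * Z')) * phi t + Z * (A * a + A' * c) * phi t' by ring.
have -> : A * a + A' * c = 0 by rewrite /A /A'; field; rewrite a0 c0 ca ac'.
rewrite mulr0 mul0r addr0 ZZ /A /F.
by field; rewrite al0 be0 c0 ca oppr_eq0 mulf_neq0.
Qed.
End DiagonalStep.

Lemma standard_prefix (W : seq box) (i : nat) : standard_filling W -> (i <= size W)%N ->
  standard_filling (take i W).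
Proof.
move=> sW; elim: sW i => [|{}W x sW IH xA] i; first by rewrite leqn0 => /eqP ->; constructor.
rewrite size_rcons leq_eqVlt => /orP[/eqP->|iW].
  by rewrite -(size_rcons W x) take_size; constructor.
by rewrite -cats1 takel_cat //; apply: IH.
Qed.

(** Taking for [D] the boxes up to the earlier label reduces the relative position of consecutive
    labels to that of a corner and an addable box. *)
Lemma standard_consecutive (W : seq box) (i : nat) : standard_filling W -> (i.+1 < size W)%N ->
  exists D : seq box, [/\ downclosed D, uniq D, (size D <= size W)%N,
    nth (0,0)%N W i \in corners D & nth (0,0)%N W i.+1 \in addable D].
Proof.
move=> sW iW; exists (take i.+1 W).
have := standard_prefix sW iW; rewrite (take_nth (0,0)%N iW) => /standard_rconsE[s1 a1].
split=> //; [exact: standard_downclosed|exact: standard_uniq| |].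
  by rewrite size_take iW ltnW.
by rewrite (take_nth (0,0)%N (ltnW iW)) in s1 *; apply: standard_last_corner.
Qed.

Lemma standard_first (W : seq box) : standard_filling W -> (0 < size W)%N ->
  nth (0,0)%N W 0 = (0,0)%N.
Proof.
move=> sW W0; have := standard_prefix sW W0; rewrite (take_nth (0,0)%N W0) take0.
move=> /standard_rconsE[_]; case: (nth _ W 0) => i j; rewrite addableP //.
by rewrite !in_nil !orbF => /and3P[_ /eqP-> /eqP->].
Qed.

(** * Diagonal action of $J_1,\dots,J_n$ *)

Section Jlow.
Variables (C : fieldType) (al be th : C) (eta : C -> C) (n : nat).
Notation q := (q al be).
Notation mu := (mu al be th n).
Hypotheses (al0 : al != 0) (be0 : be != 0) (qn : q_generic q n.*2).
Hypothesis etaP : forall x, x != 0 -> x != 1 -> eta x * eta x^-1 = - (al * be) * F al be x.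

Let q0 : q != 0. Proof. by case: qn. Qed.

(** With [dual_step_scalar], acting by $\alpha$ divides the eigenvalue by $q$, as a step to the
    right in a row does; acting by $\beta$ multiplies it by $q$, as a step down a column does. *)
Lemma al_sqr (a : C) : al ^+ 2 * a = - (al * be) * (a / q).
Proof. by rewrite /Defs.q; field; rewrite al0 oppr_eq0 be0. Qed.

Lemma be_sqr (a : C) : be ^+ 2 * a = - (al * be) * (q * a).
Proof. by rewrite /Defs.q; field. Qed.

Lemma dual_Jlow i phi BS W : standard_filling W -> size W = n -> (0 < i <= n)%N ->
  dual (Jlow al be th eta n i) phi (BS, W) = mu (BS, W) i.-1 * phi (BS, W).
Proof.
case: i => // i; elim: i phi W => [|i IH] phi W sW sz /andP[_ iN].
  by rewrite /= dual_id /mu iN /= standard_first ?sz // expr0z mul1r.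
have iW : (i.+1 < size W)%N by rewrite sz.
rewrite [Jlow _ _ _ _ _ _]/= -/(Jlow al be th eta n i.+1) /h subKn ?(ltnW iN) //.
have IHt psi : dual (Jlow al be th eta n i.+1) psi (BS, W) = mu (BS, W) i * psi (BS, W).
  by apply: IH => //; exact: ltnW.
have [D [dD uD sD ac bA]] := standard_consecutive sW iW.
have qD : q_generic q (size D).*2 by apply: q_generic_le qn; rewrite leq_double -sz.
have m1 : mu (BS, W) i = wt q (nth (0,0)%N W i) by rewrite /mu (ltnW iN).
have m2 : mu (BS, W) i.+1 = wt q (nth (0,0)%N W i.+1) by rewrite /mu iN.
have [c|nc] := boolP (collinear (nth (0,0)%N W i) (nth (0,0)%N W i.+1)).
  case: (corner_addable_collinear dD ac bA c) => -[hd e].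
    apply: (@dual_step_scalar _ _ _ _ _ _ _ _ al0 be0 al) => //; first by rewrite /hW /= e eqxx.
    by rewrite al_sqr m1 m2 /wt hd expfzDr.
  apply: (@dual_step_scalar _ _ _ _ _ _ _ _ al0 be0 be) => //; last first.
    by rewrite be_sqr m1 m2 /wt hd expfzDr // [q * _]mulrC.
  rewrite /hW /= e eqxx; case: eqP => // e'.
  case/negP: (addable_notin bA).
  by rewrite [X in X \in _]surjective_pairing -e' -e -surjective_pairing corner_mem.
have sW' := standard_swap sW iW nc.
have m1' : mu (BS, swap (0,0)%N W i) i = mu (BS, W) i.+1.
  by rewrite /mu iN (ltnW iN) /= nth_swap ?(ltnW iW) // /tr eqxx.
have m2' : mu (BS, swap (0,0)%N W i) i.+1 = mu (BS, W) i.
  by rewrite /mu iN (ltnW iN) /= nth_swap // /tr eqn_leq ltnn eqxx.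
have w12 : mu (BS, W) i != mu (BS, W) i.+1 by rewrite m1 m2 (wt_corner_addable dD qD).
have w1 : mu (BS, W) i != 0 by rewrite m1 wt_neq0.
have w2 : mu (BS, W) i.+1 != 0 by rewrite m2 wt_neq0.
move: nc; rewrite /collinear negb_or => /andP[/negPf r /negPf cl].
apply: (@dual_step_swap _ _ _ _ _ _ _ _ al0 be0 (BS, swap (0,0)%N W i)
   (eta (mu (BS, W) i / mu (BS, W) i.+1)) (eta (mu (BS, W) i.+1 / mu (BS, W) i)) phi w1 w2 w12) => //.
- by rewrite /hW /= r cl.
- rewrite /hW -pred_Sn m1' m2' /= !nth_swap ?(ltnW iW) // /tr eqxx (eqn_leq i.+1) ltnn /= eqxx.
  by rewrite eq_sym r eq_sym cl swapK.
- rewrite -[X in eta _ * eta X]invf_div etaP ?mulf_neq0 ?invr_eq0 //.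
  by apply: contra w12 => /eqP e; rewrite -[X in X == _](divfK w2) e mul1r.
by move=> psi; rewrite IH ?size_swap ?(ltnW iN) //= m1'.
Qed.
End Jlow.
(* Reversed on S, which is antistandard. *)
Definition label_before (x y : bool * box) : bool :=
  (x.1 && y.1 && before x.2 y.2) || (~~ x.1 && ~~ y.1 && before y.2 x.2).

Definition ordered (T : Type) (x0 : T) (r : rel T) (s : seq T) : Prop :=
  forall k l, (k < size s)%N -> (l < size s)%N -> r (nth x0 s k) (nth x0 s l) -> (k < l)%N.

(** An adjacent exchange reverses the order of no other pair than the exchanged one. *)
Lemma ordered_swap (T : Type) (x0 : T) (r : rel T) (s : seq T) i : (i.+1 < size s)%N ->
  ordered x0 r s -> ~~ r (nth x0 s i) (nth x0 s i.+1) -> ordered x0 r (swap x0 s i).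
Proof.
move=> iS os nr k l; rewrite size_swap => ks ls; rewrite !nth_swap // => rkl.
have := os _ _ (tr_lt iS ks) (tr_lt iS ls) rkl; move: rkl; rewrite /tr.
case: (eqVneq k i) => [->|ki]; case: (eqVneq l i) => [->|li].
- by rewrite ltnn.
- by case: eqP => [->|]; lia.
- by case: (eqVneq k i.+1) => [->|]; [move=> h; rewrite h in nr | lia].
by do 2!case: eqP; lia.
Qed.

(** No box lies after the last one in its row or column, so removing it leaves a diagram. *)
Lemma standard_of_ordered (W : seq box) : uniq W -> downclosed W ->
  ordered (0,0)%N before W -> standard_filling W.
Proof.
elim/last_ind: W => [|W z IH]; first by constructor.
rewrite rcons_uniq => /andP[zW uW] dWz oW.
have zmax b : b \in W -> ~~ before z b.
  move=> bW; apply/negP => zb; have := oW (size W) (index b W).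
  rewrite size_rcons !nth_rcons ltnn eqxx index_mem bW nth_index // ltnS leqnn.
  move=> /(_ isT _ zb); rewrite ltnS (ltnW _) ?index_mem // => /(_ isT).
  by rewrite ltnNge ltnW ?index_mem.
have dW : downclosed W.
  have [Hr Hc] := downclosedP _ dWz; apply/downclosedP; split=> i j ij.
    have := Hr i j; rewrite !mem_rcons !inE ij orbT => /(_ isT)/orP[/eqP e|//].
    by have := zmax _ ij; rewrite -e /before /= eqxx ltnSn orbT.
  have := Hc i j; rewrite !mem_rcons !inE ij orbT => /(_ isT)/orP[/eqP e|//].
  by have := zmax _ ij; rewrite -e /before /= eqxx ltnSn.
apply: Standard_rcons; last by rewrite addableE zW -(eq_downclosed (mem_rcons W z)).
apply: IH => // k l kW lW; have := oW k l; rewrite size_rcons !nth_rcons kW lW.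
by apply; apply: leqW.
Qed.

Lemma downclosed_ydboxes (la : seq nat) : ydiagram la -> downclosed (ydboxes la).
Proof.
move=> /andP[sla _]; have memE i j : ((i, j) \in ydboxes la) = (j < nth 0%N la i)%N.
  apply/allpairsPdep/idP => [[x [y [_]]]|ij]; first by rewrite mem_iota => yl [-> ->].
  exists i, j; rewrite !mem_iota /= ij; split=> //.
  by rewrite ltnNge; apply: contraL ij => il; rewrite nth_default.
apply/downclosedP; split=> i j; rewrite !memE; last exact: ltnW.
move=> h; apply: leq_trans h _; have [il|il] := ltnP i.+1 (size la); last by rewrite nth_default.
have := sorted_leq_nth _ _ 0%N sla; apply=> //.
- by move=> x y z /= yx xz; apply: leq_trans xz yx.
- by move=> x /=.
- by rewrite inE ltnW.
Qed.

Lemma uniq_ydboxes (la : seq nat) : uniq (ydboxes la).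
Proof.
apply: allpairs_uniq_dep => [|i _|[i j] [k l] _ _ /= [-> ->] //]; exact: iota_uniq.
Qed.

Lemma size_ydboxes (la : seq nat) : size (ydboxes la) = sumn la.
Proof.
rewrite size_allpairs_dep -[in RHS](mkseq_nth 0%N la) /mkseq; congr sumn.
by apply: eq_map => i; rewrite size_iota.
Qed.

(** A box of the convex set [X] strictly between [a] and [c] would need a label strictly between [j]
    and [j.+1]. So boxes on a common line are adjacent, and boxes on a common diagonal are excluded
    by a box of the rectangle they span. Labels enter as a relation [P] so that they may be
    renumbered. *)
Lemma consecutive_boxes (X : seq box) (P : nat -> box -> Prop) (j : nat) (a c : box) :
  (forall p r s : box, p \in X -> r \in X -> (p.1 <= s.1 <= r.1)%N -> (p.2 <= s.2 <= r.2)%N ->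
    s \in X) ->
  (forall s, s \in X -> exists k, P k s) ->
  (forall k l p r, P k p -> P l r -> before p r -> (k < l)%N) ->
  a \in X -> c \in X -> P j a -> P j.+1 c -> a <> c ->
  [/\ a.1 = c.1 -> HD c = HD a - 1, a.2 = c.2 -> HD c = HD a + 1 & HD a <> HD c].
Proof.
move=> conv cover ord aX cX Pa Pc nac.
have ca : ~~ before c a by apply/negP => /(ord _ _ _ _ Pc Pa); lia.
have mid s : s \in X -> before a s -> ~~ before s c.
  move=> /cover[k Pk] /(ord _ _ _ _ Pa Pk) h1; apply/negP => /(ord _ _ _ _ Pk Pc); lia.
have mid' s : s \in X -> before c s -> ~~ before s a.
  move=> /cover[k Pk] /(ord _ _ _ _ Pc Pk) h1; apply/negP => /(ord _ _ _ _ Pk Pa); lia.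
have conv1 := conv a c; have conv2 := conv c a.
case: a c aX cX {Pa Pc conv} nac ca mid mid' conv1 conv2 => [i k] [i' k'] aX cX nac ca mid mid' c1 c2.
rewrite /HD /=; split=> e.
- subst i'; have kk : k <> k' by move=> e; apply: nac; rewrite e.
  have lt : (k < k')%N by move: ca; rewrite /before /= eqxx /=; lia.
  suff -> : k' = k.+1 by lia.
  apply/eqP; rewrite eqn_leq lt andbT leqNgt; apply/negP => lt2.
  have /mid : (i, k.+1) \in X by apply: c1 => //=; lia.
  by rewrite /before /= eqxx ltnSn lt2 => /(_ isT).
- subst k'; have kk : i <> i' by move=> e; apply: nac; rewrite e.
  have lt : (i < i')%N by move: ca; rewrite /before /= eqxx /=; lia.
  suff -> : i' = i.+1 by lia.
  apply/eqP; rewrite eqn_leq lt andbT leqNgt; apply/negP => lt2.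
  have /mid : (i.+1, k) \in X by apply: c1 => //=; lia.
  by rewrite /before /= eqxx ltnSn lt2 !orbT => /(_ isT).
case: (ltngtP i i') => lt.
- have lt2 : (k < k')%N by lia.
  have /mid : (i, k') \in X by apply: c1 => //=; lia.
  by rewrite /before /= !eqxx lt lt2 !orbT => /(_ isT).
- have lt2 : (k' < k)%N by lia.
  have /mid' : (i', k) \in X by apply: c2 => //=; lia.
  by rewrite /before /= !eqxx lt lt2 !orbT => /(_ isT).
by apply: nac; congr pair; lia.
Qed.

(** * Consecutive and first labels in [B] and [S] *)

Section WellLabelled.
Variables (LB LS W : seq box).
Hypotheses (uLB : uniq LB) (dLB : downclosed LB) (dLS : downclosed LS).
Hypotheses (uW : uniq W) (dW : downclosed W).
Notation x0 := (true, (0,0)%N).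
Let DS := [seq b <- W | b \notin LS].

Definition well_labelled (BS : seq (bool * box)) : Prop :=
  [/\ perm_eq [seq p.2 | p <- BS & p.1] LB,
      perm_eq [seq p.2 | p <- BS & ~~ p.1] DS & ordered x0 label_before BS].

Lemma well_labelled_swap BS i : (i.+1 < size BS)%N -> well_labelled BS ->
  ~~ label_before (nth x0 BS i) (nth x0 BS i.+1) -> well_labelled (swap x0 BS i).
Proof.
move=> iS [pB pS oBS] nb; have pw := perm_swap x0 iS; split; last exact: ordered_swap.
  by rewrite (perm_trans _ pB) // perm_map // perm_filter.
by rewrite (perm_trans _ pS) // perm_map // perm_filter.
Qed.

Lemma mem_labelled BS fl b : well_labelled BS ->
  ((fl, b) \in BS) = (b \in if fl then LB else DS).
Proof.
case=> pB pS _; case: fl; rewrite -?(perm_mem pB) -?(perm_mem pS); apply/idP/mapP.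
- by exists (true, b) => //; rewrite mem_filter.
- by case=> -[fl c]; rewrite mem_filter /= => /andP[-> cB] ->.
- by exists (false, b) => //; rewrite mem_filter.
by case=> -[fl c]; rewrite mem_filter /= => /andP[/negPf-> cB] ->.
Qed.

Lemma uniq_labelled BS : well_labelled BS -> uniq BS.
Proof.
case=> pB pS _; have := perm_uniq pB; have := perm_uniq pS.
rewrite uLB filter_uniq // => {pB pS}.
elim: BS => //= -[[] b] BS IH /= uS uB.
  case/andP: uB => nb uB; rewrite IH // andbT; apply: contra nb => bB.
  by apply/mapP; exists (true, b); rewrite // mem_filter.
case/andP: uS => nb uS; rewrite IH // andbT; apply: contra nb => bB.
by apply/mapP; exists (false, b); rewrite // mem_filter.
Qed.

Lemma consecutive_B BS j a c : well_labelled BS -> (j.+1 < size BS)%N ->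
  nth x0 BS j = (true, a) -> nth x0 BS j.+1 = (true, c) ->
  [/\ a.1 = c.1 -> HD c = HD a - 1, a.2 = c.2 -> HD c = HD a + 1 & HD a <> HD c].
Proof.
move=> wBS jS ea ec; have [_ _ oBS] := wBS; have uBS := uniq_labelled wBS.
have memB b : b \in LB -> (true, b) \in BS by rewrite (mem_labelled true b wBS).
apply: (@consecutive_boxes LB (fun k b => (k < size BS)%N /\ nth x0 BS k = (true, b)) j).
- by move=> [p1 p2] [r1 r2] [s1 s2] _ rX /andP[_ h1] /andP[_ h2]; apply: downclosed_le rX h1 h2.
- by move=> s /memB sB; exists (index (true, s) BS); rewrite index_mem nth_index.
- move=> k l p r [kS ek] [lS el] pr; apply: (oBS k l kS lS).
  by rewrite ek el /label_before /= pr.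
- by rewrite -(mem_labelled true a wBS) -ea mem_nth // ltnW.
- by rewrite -(mem_labelled true c wBS) -ec mem_nth.
- by rewrite ltnW.
- by [].
move=> e; move: ea; rewrite e -ec => /eqP; rewrite nth_uniq ?(ltnW jS) //; lia.
Qed.

Lemma consecutive_S BS j a c : well_labelled BS -> (j.+1 < size BS)%N ->
  nth x0 BS j = (false, a) -> nth x0 BS j.+1 = (false, c) ->
  [/\ a.1 = c.1 -> HD a = HD c - 1, a.2 = c.2 -> HD a = HD c + 1 & HD c <> HD a].
Proof.
move=> wBS jS ea ec; have [_ _ oBS] := wBS; have uBS := uniq_labelled wBS.
have memB b : b \in DS -> (false, b) \in BS by rewrite (mem_labelled false b wBS).
suff [h1 h2 h3] : [/\ c.1 = a.1 -> HD a = HD c - 1, c.2 = a.2 -> HD a = HD c + 1 & HD c <> HD a].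
  by split=> [/esym|/esym|].
pose P k b := (k < size BS)%N /\ nth x0 BS ((size BS).-1 - k) = (false, b).
(* Reversing the labels makes the antistandard filling increasing; [c], with original index [j.+1],
   becomes the earlier box. Convexity holds since [DS] is a skew shape. *)
apply: (@consecutive_boxes DS P (size BS - j.+2)).
- move=> [p1 p2] [r1 r2] [s1 s2]; rewrite !mem_filter.
  move=> /andP[np _] /andP[_ rX] /andP[/= h1 h2] /andP[/= h3 h4].
  rewrite (downclosed_le dW rX h2 h4) andbT.
  by apply: contra np => sL; apply: downclosed_le sL h1 h3.
- move=> s /memB sB; exists ((size BS).-1 - index (false, s) BS)%N.
  have ix : (index (false, s) BS < size BS)%N by rewrite index_mem.
  split; first by lia.
  by rewrite subKn ?nth_index //; lia.
- move=> k l p r [kS ek] [lS el] pr.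
  suff : ((size BS).-1 - l < (size BS).-1 - k)%N by lia.
  have lt N i i' : (i < N -> N.-1 - i' < N)%N by lia.
  apply: oBS; [exact: lt lS|exact: lt lS|].
  by rewrite ek el /label_before /= pr.
- by rewrite -(mem_labelled false c wBS) -ec mem_nth.
- by rewrite -(mem_labelled false a wBS) -ea mem_nth // ltnW.
- split; first by lia.
  by rewrite (_ : _ - _ = j.+1)%N //; lia.
- split; first by lia.
  by rewrite (_ : _ - _ = j)%N //; lia.
move=> e; move: ea; rewrite -e -ec => /eqP; rewrite nth_uniq ?(ltnW jS) //; lia.
Qed.

Lemma first_B BS b : well_labelled BS -> (0 < size BS)%N -> nth x0 BS 0 = (true, b) ->
  b = (0,0)%N.
Proof.
move=> wBS S0 eb; have [_ _ oBS] := wBS.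
have bB : b \in LB by rewrite -(mem_labelled true b wBS) -eb mem_nth.
have nb c : c \in LB -> ~~ before c b.
  rewrite -(mem_labelled true c wBS) => cB; apply/negP => cb.
  have := oBS (index (true, c) BS) 0%N; rewrite index_mem cB nth_index // eb.
  by rewrite /label_before /= cb => /(_ isT S0 isT).
have [Hr Hc] := downclosedP _ dLB; case: b {eb} bB nb => [[|i] [|j]] // bB nb.
- by have := nb _ (Hc _ _ bB); rewrite /before /= ?eqxx ltnSn.
- by have := nb _ (Hr _ _ bB); rewrite /before /= ?eqxx ltnSn ?orbT.
by have := nb _ (Hc _ _ bB); rewrite /before /= ?eqxx ltnSn.
Qed.

(** [S] decreases along rows and columns, so its smallest possible label has no box of [S], hence
    none of [W], to the right or below. *)
Lemma first_S BS b : well_labelled BS -> (0 < size BS)%N -> nth x0 BS 0 = (false, b) ->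
  b \in corners W.
Proof.
move=> wBS S0 eb; have [_ _ oBS] := wBS.
have bD : b \in DS by rewrite -(mem_labelled false b wBS) -eb mem_nth.
have nb c : c \in DS -> ~~ before b c.
  rewrite -(mem_labelled false c wBS) => cB; apply/negP => cb.
  have := oBS (index (false, c) BS) 0%N; rewrite index_mem cB nth_index // eb.
  by rewrite /label_before /= cb => /(_ isT S0 isT).
case: b {eb} bD nb => i j; rewrite mem_filter => /andP[nL bW] nb.
have [Hr Hc] := downclosedP _ dLS; rewrite cornersE // bW /=.
apply/andP; split; apply/negP => H.
  have := nb (i.+1, j); rewrite mem_filter H andbT (contra (Hr i j) nL) => /(_ isT).
  by rewrite /before /= ?eqxx ltnSn ?orbT.
have := nb (i, j.+1); rewrite mem_filter H andbT (contra (Hc i j) nL) => /(_ isT).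
by rewrite /before /= ?eqxx ltnSn.
Qed.
End WellLabelled.

(** * Diagonal action of $J_{n+1},\dots,J_{n+m}$ *)

Section Jup.
Variables (C : fieldType) (al be ka th : C) (eta zeta : C -> C) (m n : nat).
Variables (LB LS W : seq box).
Notation q := (q al be).
Notation mu := (mu al be th n).
Notation x0 := (true, (0,0)%N).
Notation J := (Jup al be ka th eta zeta n).
Hypotheses (al0 : al != 0) (be0 : be != 0) (ka0 : ka != 0) (th0 : th != 0).
Hypothesis qmn : q_generic q (m + n).*2.
Hypothesis th_generic : forall k : int, (`|k| <= (m + n).*2)%N -> - th * q ^ k != 1.
Hypothesis etaP : forall x, x != 0 -> x != 1 -> eta x * eta x^-1 = - (al * be) * F al be x.
Hypothesis zetaP : forall x, x != 0 -> x != 1 -> zeta x * zeta x^-1 = - (al * be) * F al be x.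
Hypotheses (uLB : uniq LB) (dLB : downclosed LB) (sLB : (size LB <= m)%N) (dLS : downclosed LS).
Hypotheses (sW : standard_filling W) (szW : size W = n) (n0 : (0 < n)%N).

Let q0 : q != 0. Proof. by case: qmn. Qed.
Let uW := standard_uniq sW.
Let dW := standard_downclosed sW.
Notation labelled := (well_labelled LB LS W).

Let weight (p : bool * box) : C := if p.1 then q ^ HD p.2 else - th * q ^ (- HD p.2).

Lemma mu_primed BS k : mu (BS, W) (n + k) = weight (nth x0 BS k).
Proof. by rewrite /mu ltnNge leq_addr /= addKn. Qed.

Let weight0 p : weight p != 0.
Proof.
by rewrite /weight; case: p.1; rewrite ?mulf_neq0 ?oppr_eq0 // expfz_neq0.
Qed.

(** Within [B] or within [S] distinct contents suffice; between them equality would read $-\theta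
    q^k=1$ with $k$ minus the sum of the two contents. *)
Lemma weight_neq BS k l fl fl' a b : labelled BS ->
  nth x0 BS k = (fl, a) -> nth x0 BS l = (fl', b) -> (k < size BS)%N -> (l < size BS)%N ->
  (fl = fl' -> HD a <> HD b) -> weight (fl, a) != weight (fl', b).
Proof.
move=> wBS ea eb kS lS ne.
have bound i f c : (i < size BS)%N -> nth x0 BS i = (f, c) -> (`|HD c| <= m + n)%N.
  move=> iS ec; have := mem_nth x0 iS; rewrite ec (mem_labelled f c wBS).
  case: f {ec} => [/(HD_bound dLB)|]; first by move: sLB; clear; lia.
  by rewrite mem_filter => /andP[_ /(HD_bound dW)]; rewrite szW; clear; lia.
have ba := bound _ _ _ kS ea; have bb := bound _ _ _ lS eb; clear bound ea eb kS lS wBS.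
rewrite /weight; case: fl fl' ne => [] [] /= ne.
- apply/eqP => /(q_generic_inj qmn) e; apply: ne => //; apply: e; clear -ba bb; lia.
- apply/eqP => e; have : - th * q ^ (- HD b - HD a) != 1.
    by apply: th_generic; clear -ba bb; lia.
  by rewrite expfzDr // mulrA -e -expfzDr // subrr expr0z eqxx.
- apply/eqP => e; have : - th * q ^ (- HD a - HD b) != 1.
    by apply: th_generic; clear -ba bb; lia.
  by rewrite expfzDr // mulrA e -expfzDr // subrr expr0z eqxx.
apply/eqP => /(mulfI _) e; apply: ne => //; apply: oppr_inj.
apply: (q_generic_inj qmn); first by clear -ba bb; lia.
by apply: e; rewrite oppr_eq0.
Qed.

Lemma dual_Jup j BS phi : labelled BS -> size BS = m -> (0 < j <= m)%N ->
  dual (J j) phi (BS, W) = mu (BS, W) (n + j).-1 * phi (BS, W).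
Proof.
case: j => // j; elim: j BS phi => [|j IH] BS phi wBS sBS /andP[_ jm].
  have S0 : (0 < size BS)%N by rewrite sBS.
  rewrite addn1 /= -[n in mu _ n]addn0 mu_primed.
  case eb: (nth x0 BS 0) => [[] b].
    by rewrite (dual_Jn1_B _ _ _ _ _ _ eb) // (first_B dLB wBS S0 eb) /weight /= expr0z mul1r.
  rewrite (dual_Jn1_S _ _ eb) //; first by case: (BS) S0.
    by apply: q_generic_le qmn; rewrite leq_double leq_addl.
  exact: (first_S dLS dW wBS S0 eb).
have jS : (j.+1 < size BS)%N by rewrite sBS.
rewrite [Jup _ _ _ _ _ _ _ _]/= -/(Jup al be ka th eta zeta n j.+1).
have e1 : (n + j.+1).-1 = (n + j)%N by rewrite addnS.
have e2 : (n + j.+2).-1 = (n + j.+1)%N by rewrite addnS.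
have IHt BS' psi : labelled BS' -> size BS' = m ->
    dual (J j.+1) psi (BS', W) = mu (BS', W) (n + j) * psi (BS', W).
  by move=> w' s'; rewrite IH // ?e1 //; apply: ltnW.
rewrite e2.
have [fa [a ea]] : exists fl a, nth x0 BS j = (fl, a).
  by case: (nth x0 BS j) => fl x; exists fl, x.
have [fc [c ec]] : exists fl a, nth x0 BS j.+1 = (fl, a).
  by case: (nth x0 BS j.+1) => fl x; exists fl, x.
have Mt : g al be th zeta n j.+1 (BS, W) =
  if (fa == fc) && (a.1 == c.1) then [:: (al, (BS, W))]
  else if (fa == fc) && (a.2 == c.2) then [:: (be, (BS, W))]
  else [:: ((al + be) / (1 - mu (BS, W) (n + j) / mu (BS, W) (n + j.+1)), (BS, W));
           (zeta (mu (BS, W) (n + j) / mu (BS, W) (n + j.+1)), (swap x0 BS j, W))].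
  by rewrite /g e1 /= ea ec.
have scal s : g al be th zeta n j.+1 (BS, W) = [:: (s, (BS, W))] ->
    s ^+ 2 * weight (fa, a) = - (al * be) * weight (fc, c) ->
    dual (opscale (- (al * be))^-1 (opcomp (g al be th zeta n j.+1)
      (opcomp (J j.+1) (g al be th zeta n j.+1)))) phi (BS, W) =
    mu (BS, W) (n + j.+1) * phi (BS, W).
  move=> h1 h2; apply: (@dual_step_scalar _ _ _ _ _ _ _ _ al0 be0 s) => //.
    by move=> psi; apply: IHt.
  by rewrite !mu_primed ea ec.
have [nc|nc] := boolP ((fa == fc) && collinear a c).
  case/andP: nc Mt => /eqP fac; rewrite -fac eqxx /= => col.
  rewrite -fac {fc fac} in ec scal; case: fa ea ec scal => ea ec scal Mt.
    have [h1 h2 _] := consecutive_B uLB dLB dLS uW dW wBS jS ea ec.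
    case: eqP Mt => [/h1 hd|ne] Mt.
      by apply: scal Mt _; rewrite (al_sqr al0 be0) /weight /= hd expfzDr.
    have e : a.2 = c.2 by move: col; rewrite /collinear => /orP[/eqP/ne|/eqP].
  move: (h2 e) Mt => hd; rewrite e eqxx => Mt.
      by apply: scal Mt _; rewrite (be_sqr be al0) /weight /= hd expfzDr // [q * _]mulrC.
  have [h1 h2 _] := consecutive_S uLB dLB dLS uW dW wBS jS ea ec.
  case: eqP Mt => [/h1 hd|ne] Mt.
    apply: scal Mt _; rewrite (al_sqr al0 be0) /weight /= hd opprB addrC expfzDr //.
    by rewrite -mulrA mulfK.
  have e : a.2 = c.2 by move: col; rewrite /collinear => /orP[/eqP/ne|/eqP].
  move: (h2 e) Mt => hd; rewrite e eqxx => Mt.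
  apply: scal Mt _; rewrite (be_sqr be al0) /weight /= hd opprD expfzDr //.
  by rewrite [q * _]mulrC -mulrA divfK.
(* Being off a common line is not enough: a common diagonal must also be excluded, so that the
   weight ratio differs from 1 and the relation for [zeta] applies. *)
have HDne : fa = fc -> HD a <> HD c.
  move=> e; rewrite -e in ec; case: fa ea {Mt scal e nc} ec => ea ec.
    by have [] := consecutive_B uLB dLB dLS uW dW wBS jS ea ec.
  by have [_ _ h /esym] := consecutive_S uLB dLB dLS uW dW wBS jS ea ec.
have wac : mu (BS, W) (n + j) != mu (BS, W) (n + j.+1).
  by rewrite !mu_primed ea ec; apply: (weight_neq wBS ea ec) => //; apply: ltnW.
have w1 : mu (BS, W) (n + j) != 0 by rewrite mu_primed.
have w2 : mu (BS, W) (n + j.+1) != 0 by rewrite mu_primed.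
have wBS' : labelled (swap x0 BS j).
  apply: well_labelled_swap => //; rewrite ea ec; apply: contra nc.
  rewrite /label_before /before /collinear /=.
  case: fa {ea Mt scal HDne} fc {ec} => [] [] //=; rewrite ?orbF.
    by move=> /orP[]/andP[-> _]; rewrite ?orbT.
  by rewrite ![c.1 == _]eq_sym ![c.2 == _]eq_sym => /orP[]/andP[-> _]; rewrite ?orbT.
have m1 : mu (swap x0 BS j, W) (n + j) = mu (BS, W) (n + j.+1).
  by rewrite !mu_primed nth_swap ?(ltnW jS) // /tr eqxx.
have m2 : mu (swap x0 BS j, W) (n + j.+1) = mu (BS, W) (n + j).
  by rewrite !mu_primed nth_swap // /tr eqn_leq ltnn eqxx.
move: nc; rewrite negb_and => nc.
have nr : (fa == fc) && (a.1 == c.1) = false.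
  by apply/negbTE; rewrite negb_and; case/orP: nc => [->//|]; rewrite negb_or => /andP[-> _]; rewrite orbT.
have nk : (fa == fc) && (a.2 == c.2) = false.
  by apply/negbTE; rewrite negb_and; case/orP: nc => [->//|]; rewrite negb_or => /andP[_ ->]; rewrite orbT.
rewrite nr nk in Mt.
apply: (@dual_step_swap _ _ _ _ _ _ _ _ al0 be0 (swap x0 BS j, W)
   _ (zeta (mu (BS, W) (n + j.+1) / mu (BS, W) (n + j))) phi w1 w2 wac Mt).
- rewrite /g e1 m1 m2 /= !nth_swap ?(ltnW jS) // /tr eqxx (eqn_leq j.+1) ltnn /= eqxx ea ec /=.
  rewrite ![fc == _]eq_sym ![c.1 == _]eq_sym ![c.2 == _]eq_sym nr nk swapK //.
- rewrite -[X in zeta _ * zeta X]invf_div zetaP ?mulf_neq0 ?invr_eq0 //.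
  by apply: contra wac => /eqP e; rewrite -[X in X == _](divfK w2) e mul1r.
- by move=> psi; apply: IHt.
by move=> psi; rewrite IHt ?size_swap // m1.
Qed.
End Jup.
(** * The genericity polynomial *)

Section GenericPolynomial.
Variables (C : fieldType) (N : nat).
Notation poly4 := {poly {poly {poly {poly C}}}}.

Lemma eval4M (P Q : poly4) (a b k t : C) : eval4 (P * Q) a b k t = eval4 P a b k t * eval4 Q a b k t.
Proof. by rewrite /eval4 !hornerM. Qed.

Lemma eval4D (P Q : poly4) (a b k t : C) : eval4 (P + Q) a b k t = eval4 P a b k t + eval4 Q a b k t.
Proof. by rewrite /eval4 !hornerD. Qed.

Lemma eval4N (P : poly4) (a b k t : C) : eval4 (- P) a b k t = - eval4 P a b k t.
Proof. by rewrite /eval4 !hornerN. Qed.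

Lemma eval4_1 (a b k t : C) : eval4 (1 : poly4) a b k t = 1.
Proof. by rewrite /eval4 !hornerE. Qed.

Lemma eval4X (P : poly4) i (a b k t : C) : eval4 (P ^+ i) a b k t = eval4 P a b k t ^+ i.
Proof. by rewrite /eval4 !horner_exp. Qed.

Lemma eval4_prod (I : Type) (s : seq I) (f : I -> poly4) (a b k t : C) :
  eval4 (\prod_(i <- s) f i) a b k t = \prod_(i <- s) eval4 (f i) a b k t.
Proof. exact: (big_morph (fun P => eval4 P a b k t) (fun P Q => eval4M P Q a b k t) (eval4_1 a b k t)). Qed.

(** The nesting follows [eval4]: $\theta$ is the outermost variable, $\alpha$ the innermost. *)
Definition indet_al : poly4 := 'X%:P%:P%:P.
Definition indet_be : poly4 := 'X%:P%:P.
Definition indet_ka : poly4 := 'X%:P.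
Definition indet_th : poly4 := 'X.

Lemma eval4_indet (a b k t : C) :
  (eval4 indet_al a b k t = a) * (eval4 indet_be a b k t = b) *
  (eval4 indet_ka a b k t = k) * (eval4 indet_th a b k t = t).
Proof. by rewrite /eval4 /indet_al /indet_be /indet_ka /indet_th !hornerE. Qed.

(** With denominators cleared, the factors of the product express $q^i\ne1$, $-\theta q^{-i}\ne1$
    and $-\theta q^i\ne1$; the factor $\theta+1$ is the case $i=0$. *)
Definition generic_poly : poly4 :=
  indet_al * indet_be * indet_ka * indet_th * (indet_th + 1) *
  \prod_(i <- iota 1 N)
    ((indet_al ^+ i - (- indet_be) ^+ i) * (indet_th * indet_al ^+ i + (- indet_be) ^+ i) *
     (indet_th * (- indet_be) ^+ i + indet_al ^+ i)).

Lemma eval4_generic_poly (a b k t : C) : eval4 generic_poly a b k t =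
  a * b * k * t * (t + 1) * \prod_(i <- iota 1 N)
    ((a ^+ i - (- b) ^+ i) * (t * a ^+ i + (- b) ^+ i) * (t * (- b) ^+ i + a ^+ i)).
Proof.
rewrite /generic_poly !(eval4M, eval4D, eval4_1, eval4_indet) eval4_prod; congr (_ * _).
by apply: eq_bigr => i _; rewrite !(eval4M, eval4D, eval4N, eval4X, eval4_indet).
Qed.

Lemma generic_polyP (al be ka th : C) : eval4 generic_poly al be ka th != 0 ->
  [/\ al != 0, be != 0, ka != 0 & th != 0] /\
  q_generic (q al be) N /\
  (forall k : int, (`|k| <= N)%N -> - th * q al be ^ k != 1).
Proof.
rewrite eval4_generic_poly !mulf_eq0 !negb_or -!andbA prodf_seq_neq0.
case/and5P=> al0 be0 ka0 th0 /andP[th1 /allP fac]; split=> //.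
have {}fac i : (0 < i <= N)%N -> [/\ al ^+ i - (- be) ^+ i != 0,
    th * al ^+ i + (- be) ^+ i != 0 & th * (- be) ^+ i + al ^+ i != 0].
  move=> iN; have := fac i; rewrite mem_iota add1n ltnS => /(_ iN).
  by rewrite !mulf_eq0 !negb_or -andbA => /and3P.
have qX i : q al be ^+ i = (- be) ^+ i / al ^+ i by rewrite /q expr_div_n.
have alX i : al ^+ i != 0 by rewrite expf_neq0.
split.
  split; first by rewrite mulf_neq0 ?oppr_eq0 ?invr_eq0.
  move=> i /fac[h _ _]; rewrite qX; apply: contra h => /eqP e.
  by rewrite -[(- be) ^+ i](divfK (alX i)) e mul1r subrr.
case=> [[|i]|i] iN.
- by apply: contra th1 => /eqP e; rewrite -e expr0z mulr1 subrr.
- have [_ _] := fac i.+1 iN; apply: contra => /eqP e.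
  rewrite -[X in _ + X]mul1r -e -exprnP qX; apply/eqP; field; exact: alX.
have [_ h _] := fac i.+1 iN; apply: contra h => /eqP e.
rewrite -[(- be) ^+ i.+1]mul1r -e NegzE -exprnN qX; apply/eqP; field.
by rewrite ?alX ?expf_neq0 ?oppr_eq0.
Qed.
End GenericPolynomial.

Lemma generic_poly_neq0 (C : numFieldType) (N : nat) : generic_poly C N != 0.
Proof.
(* At this point $q=2$, and the factors $1-2^i$ and $1+2^i$ are nonzero in characteristic 0. *)
have : eval4 (generic_poly C N) 1 (- 2%:R) 1 1 != 0.
  rewrite eval4_generic_poly !mulf_neq0 ?oppr_eq0 ?pnatr_eq0 ?oner_neq0 //.
    by rewrite -[1 + 1]/(2%:R) pnatr_eq0.
  rewrite prodf_seq_neq0; apply/allP => i; rewrite mem_iota => /andP[i0 _] /=.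
  rewrite expr1n opprK !mul1r -natrX -[1]/(1%:R) -!natrD.
  rewrite !mulf_neq0 ?pnatr_eq0 ?addn_eq0 ?andbF // subr_eq0 eqr_nat.
  by case: i i0 => // i _; rewrite expnS; have := expn_gt0 2 i; case: (2 ^ i)%N => // k; lia.
by apply: contraNneq => ->; rewrite /eval4 !horner0.
Qed.
Lemma all_iota_ordered (T : Type) (x0 : T) (r : rel T) (s : seq T) (n : nat) : size s = n ->
  all (fun k => all (fun l => r (nth x0 s k) (nth x0 s l) ==> (k < l)%N) (iota 0 n)) (iota 0 n) ->
  ordered x0 r s.
Proof.
move=> <- /allP H k l ks ls; apply/implyP.
have := H k; rewrite mem_iota => /(_ ks)/allP; apply.
by rewrite mem_iota.
Qed.

Theorem theorem5p5p9 (R : realType) (m n : nat) (lam' lam : seq nat) :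
  (1 <= m)%N -> (1 <= n)%N -> ydiagram lam' -> ydiagram lam ->
  (sumn lam' <= m)%N -> (sumn lam <= n)%N -> (m - sumn lam')%N = (n - sumn lam)%N ->
  exists P : {poly {poly {poly {poly R[i]}}}}, P != 0 /\
  forall al be ka th : R[i], eval4 P al be ka th != 0 ->
  forall eta zeta : R[i] -> R[i], eta_zeta_ok al be eta zeta ->
  forall t : triple, standardTriple m n lam' lam t ->
  forall j : nat, (2 <= j <= m + n)%N ->
  forall t' : triple,
    coef (J al be ka th eta zeta n j t) t' = (if t' == t then mu al be th n t j.-1 else 0).
Proof.
(* All contents are at most $m+n$ in absolute value, so their sums and differences are at most twice
   that. *)
move=> m0 n0 yB yS sB _ _; exists (generic_poly _ (m + n).*2).
split; first exact: generic_poly_neq0.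
move=> al be ka th /generic_polyP[[al0 be0 ka0 th0] [qg thg]] eta zeta [ez _] [BS W].
case/and5P=> /eqP sW uW dW /allP _ /and5P[] /(all_iota_ordered sW) oW /eqP sBS pB pS /andP[/allP hB /allP hS].
move=> j /andP[j2 jmn] t'.
have stW := standard_of_ordered uW dW oW.
have etaP x : x != 0 -> x != 1 -> eta x * eta x^-1 = - (al * be) * F al be x.
  by move=> x0 x1; case: (ez x x0 x1).
have zetaP x : x != 0 -> x != 1 -> zeta x * zeta x^-1 = - (al * be) * F al be x.
  by move=> x0 x1; case: (ez x x0 x1).
have wBS : well_labelled (ydboxes lam') (ydboxes lam) W BS.
  split=> // k l kS lS; rewrite sBS in kS lS => /orP[]/andP[/andP[h1 h2] h3].
    have := hB k; rewrite mem_iota => /(_ kS)/allP/(_ l); rewrite mem_iota => /(_ lS).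
    by rewrite /= h1 h2 h3.
  have := hS l; rewrite mem_iota => /(_ lS)/allP/(_ k); rewrite mem_iota => /(_ kS).
  by rewrite /= h1 h2 h3.
rewrite coef_dual.
suff -> : dual (J al be ka th eta zeta n j) (fun s => (s == t')%:R) (BS, W) =
          mu al be th n (BS, W) j.-1 * ((BS, W) == t')%:R.
  by rewrite eq_sym; case: eqP => _; rewrite ?mulr1 ?mulr0.
rewrite /J; case: leqP => jn.
  apply: dual_Jlow => //; last by rewrite jn (ltnW j2).
  by apply: q_generic_le qg; rewrite leq_double leq_addl.
have -> : j.-1 = (n + (j - n)).-1 by rewrite subnKC // ltnW.
apply: (@dual_Jup _ al be ka th eta zeta m n (ydboxes lam') (ydboxes lam)) => //.
- exact: uniq_ydboxes.
- exact: downclosed_ydboxes.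
- by rewrite size_ydboxes.
- exact: downclosed_ydboxes.
by rewrite subn_gt0 jn leq_subLR addnC.
Qed.
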